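(* Let $d \geq 2$ be an integer and let $E \subset M_d^{0}(\mathbb{Z})$ satisfy $\overline{d}(E) > 0$. Then there exists an integer $k \geq 1$ such that for every polynomial $f \in \mathbb{Z}[X]$ of the form \[ f(X) = X^d + k^2 a_{d-2} X^{d-2} + k^3 a_{d-3}X^{d-3} + \ldots + k^d a_0, \quad a_0,\ldots,a_{d-2} \in \mathbb{Z}, \] (i.e. the coefficient of $X^{d-j}$ is $k^j a_{d-j}$ for $2\le j\le d$, and the coefficient of $X^{d-1}$ is $0$), there exists a matrix $A \in E - E = \{x - y : x,y \in E\}$ whose characteristic polynomial $\det(X I - A)$ equals $f$.
   Context: $M_d^0(\mathbb{Z})$ denotes the additive group of $d\times d$ integer matrices with trace zero. For $n \ge 1$ let $F_n = \{A=(a_{ij}) \in M_d^0(\mathbb{Z}) : |a_{ij}| \le n \text{ for all } (i,j) \neq (d,d)\}$. For $E \subset M_d^0(\mathbb{Z})$, its upper asymptotic density is $\overline{d}(E) = \limsup_{n\to\infty} |E \cap F_n|/|F_n|$. *)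

(* Defs.v *)
From HB Require Import structures.
From mathcomp Require Import all_boot all_order all_algebra.
From mathcomp Require Import all_classical all_reals all_analysis.
From mathcomp Require Import Rstruct.
From mathcomp Require Import zify.
Set Implicit Arguments. Unset Strict Implicit. Unset Printing Implicit Defensive.
Import Order.TTheory GRing.Theory Num.Theory.
Local Open Scope ring_scope.

Definition is_last (d : nat) (i : 'I_d) : bool := val i == d.-1.

Definition tracezero (d : nat) (A : 'M[int]_d) : Prop := \tr A = 0.

Definition inF (d n : nat) (A : 'M[int]_d) : Prop :=
  tracezero A /\
  forall i j : 'I_d, ~~ (is_last i && is_last j) -> `|A i j| <= n%:Z.

(* Explicit finite enumeration of F_n: every entry other than (d,d) ranges
   over [-n, n]; the (d,d) entry is forced by the trace condition. *)
Definition mkF (d n : nat) (f : {ffun 'I_d * 'I_d -> 'I_(2 * n).+1}) : 'M[int]_d :=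
  \matrix_(i, j)
    if is_last i && is_last j
    then - \sum_(l < d | ~~ is_last l) ((f (l, l) : nat)%:Z - n%:Z)
    else (f (i, j) : nat)%:Z - n%:Z.

Definition F_list (d n : nat) : seq 'M[int]_d :=
  undup [seq @mkF d n f | f : {ffun 'I_d * 'I_d -> 'I_(2 * n).+1}].

Definition dens_ratio (d : nat) (E : set 'M[int]_d) (n : nat) : Rdefinitions.R :=
  (count (fun A => `[< E A >]) (F_list d n))%:R / (size (F_list d n))%:R.

Definition upper_density (d : nat) (E : set 'M[int]_d) : Rdefinitions.R :=
  limn_sup (dens_ratio E).

Definition scaled_poly (d : nat) (k : int) (a : nat -> int) : {poly int} :=
  'X^d + \sum_(i < d.-1) (k ^+ (d - i) * a i)%:P * 'X^i.

Lemma F_list_uniq d n : uniq (F_list d n).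
Proof. exact: undup_uniq. Qed.
Lemma trace_split d (A : 'M[int]_d) (l : 'I_d) : is_last l ->
  \tr A = A l l + \sum_(i < d | ~~ is_last i) A i i.
Proof.
move=> hl; rewrite /mxtrace (bigD1 l) //=; congr (_ + _).
apply: eq_bigl => i; rewrite /is_last; move: hl; rewrite /is_last => /eqP hl.
apply/idP/idP; first by apply: contra => /eqP h; apply/eqP/val_inj; rewrite /= h hl.
by apply: contra => /eqP ->; rewrite hl.
Qed.

Lemma last_uniq d (i j : 'I_d) : is_last i -> is_last j -> i = j.
Proof. by rewrite /is_last => /eqP hi /eqP hj; apply/val_inj; rewrite /= hi hj. Qed.

Lemma mem_F_list d n (A : 'M[int]_d) : (0 < d)%N ->
  (A \in F_list d n) <-> inF n A.
Proof.
move=> d0; have ld : (d.-1 < d)%N by rewrite prednK.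
pose l := Ordinal ld; have hl : is_last l by rewrite /is_last.
rewrite mem_undup; split.
- case/mapP => f _ ->; split.
    rewrite /tracezero (@trace_split _ _ _ hl) !mxE hl /=.
    rewrite [X in _ + X](eq_bigr (fun i => (f (i, i) : nat)%:Z - n%:Z)).
      by rewrite addNr.
    by move=> i /negbTE hi; rewrite mxE hi.
  move=> i j /negbTE h; rewrite mxE h.
  have := ltn_ord (f (i, j)); move: (nat_of_ord (f (i, j))) => m hm.
  rewrite ler_norml; apply/andP; split; lia.
- case=> htr hb.
  pose f := [ffun p : 'I_d * 'I_d => (inord (absz (A p.1 p.2 + n%:Z)) : 'I_(2 * n).+1)].
  have hf : forall i j, ~~ (is_last i && is_last j) ->
      ((f (i, j) : nat)%:Z - n%:Z = A i j).
    move=> i j h; rewrite ffunE /= inordK.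
      have := hb i j h; rewrite ler_norml => /andP [h1 h2].
      rewrite gez0_abs; [by rewrite addrK | lia].
    have := hb i j h; rewrite ler_norml => /andP [h1 h2]; lia.
  apply/mapP; exists f; first by rewrite mem_enum.
  apply/matrixP => i j; rewrite mxE.
  case: ifP => h; last by rewrite hf // h.
  case/andP: h => hi hj; rewrite (@last_uniq _ _ _ hj hi) (@last_uniq _ _ _ hi hl).
  move: htr; rewrite /tracezero (@trace_split _ _ _ hl) => /eqP; rewrite addr_eq0 => /eqP ->.
  congr (- _); apply: eq_bigr => k hk; rewrite hf //; apply: contra hk; by case/andP.
Qed.

(* Main.v *)
(** Matrices with a given characteristic polynomial are stable under conjugation,
    and conjugating a companion matrix by products of [1 + n^m E_ij] yields a
    polynomial family [P n] whose non-constant coefficients generate all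
    trace-zero integer matrices. It therefore suffices to find [k], depending on
    [E] only, such that [k P n] lies in [E - E] for some [n], for every such [P].

    Averages over the boxes [F_n] along an ultrafilter give an invariant mean, and
    translations act isometrically on bounded functions with the resulting
    semi-inner product. Let [m_q] be the infimum of the squared norms of the
    convex combinations of the translates of [e], the indicator of [E], by [q]
    times the lattice. It is monotone for divisibility, bounded, and at least
    the square of the density, so for some [k] the value [m_k] is almost the
    supremum. Van der Corput's inequality, one coefficient at a time, shows that
    the averages of the translates of [e] by [k P n] do not change much when [e]
    is replaced by an almost shortest convex combination [h] over [k] times the
    lattice; and [e] has positive inner product with every such translate of
    [h]. *)

Require Import Defs.
From HB Require Import structures.
From mathcomp Require Import all_boot all_order all_algebra.
From mathcomp Require Import all_classical all_reals all_analysis.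
From mathcomp Require Import Rstruct.
From mathcomp Require Import ring lra zify.
Set Implicit Arguments. Unset Strict Implicit. Unset Printing Implicit Defensive.
Import Order.TTheory GRing.Theory Num.Theory.
Local Open Scope ring_scope.

(** * Polynomial sequences *)

Lemma nat_upper_bound (R : realType) (x : R) :
  exists N : nat, forall M : nat, (N <= M)%N -> x <= M%:R.
Proof.
exists (Num.bound `|x|) => M NM.
apply: le_trans (ler_norm x) _; apply: ltW.
apply: lt_le_trans (archi_boundP (normr_ge0 x)) _.
by rewrite ler_nat.
Qed.

Lemma eventually_forall_lt (H : nat) (Q : nat -> nat -> Prop) :
  (forall h, (h < H)%N -> exists M0, forall M, (M0 <= M)%N -> Q h M) ->
  exists M0, forall M, (M0 <= M)%N -> forall h, (h < H)%N -> Q h M.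
Proof.
elim: H => [|H IH] hQ; first by exists 0%N.
have [h hH|M1 hM1] := IH; first by apply: hQ; apply: ltnW.
have [M2 hM2] := hQ H (ltnSn H).
exists (maxn M1 M2) => M; rewrite geq_max => /andP[h1 h2] h.
rewrite ltnS leq_eqVlt => /predU1P[->|hH]; first exact: hM2.
exact: hM1.
Qed.

Section NearMin.
Local Open Scope classical_set_scope.

(** By [Phimul] the infima of the sets [Phi q] grow along divisibility, and they are at most 1. If
    the infimum at [q] is within [eps / 2] of their supremum, then no multiple of [q] has an infimum
    larger by more than [eps / 2]; the other half of [eps] pays for a point close to that
    infimum. *)
Lemma near_minimal_scale (R : realType) (Phi : nat -> set R) (eps : R) :
  0 < eps ->
  (forall q, Phi q !=set0) -> (forall q x, Phi q x -> 0 <= x <= 1) ->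
  (forall q q', (0 < q)%N -> (0 < q')%N -> Phi (q * q')%N `<=` Phi q) ->
  exists q m, [/\ (0 < q)%N, forall x, Phi q x -> m <= x &
    forall q', (0 < q')%N -> exists2 x, Phi (q * q')%N x & x <= m + eps].
Proof.
move=> eps0 Phin0 Phib Phimul.
have Phil q : has_lbound (Phi q).
  by exists 0 => x /Phib /andP[].
have Phii q : has_inf (Phi q) by split.
pose I := [set inf (Phi q) | q in [set q | (0 < q)%N]].
have Is : has_sup I.
  split; first by exists (inf (Phi 1%N)); exists 1%N.
  exists 1 => _ [q _ <-]; have [x Px] := Phin0 q.
  apply: le_trans (ge_inf (Phil q) Px) _.
  by have /andP[] := Phib _ _ Px.
have e2 : 0 < eps / 2 by rewrite divr_gt0.
have [_ [q q0 <-] hq] := sup_adherent e2 Is.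
exists q, (inf (Phi q)); split=> // [x Px|q' q'0]; first exact: ge_inf.
have [x Px hx] := inf_adherent e2 (Phii (q * q')%N).
exists x => //; apply: (le_trans (ltW hx)).
have : inf (Phi (q * q')%N) <= sup I.
  by apply: sup_ubound; [case: Is | exists (q * q')%N => //=; rewrite muln_gt0 q0].
lra.
Qed.

End NearMin.

Section PolynomialSequences.
Variable G : zmodType.
Implicit Types (c : G) (p : nat -> G).

(* [p] is polynomial of degree at most [D] with iterated [D]-th difference [c],
   that is, [D!] times the coefficient of degree [D]. *)
Fixpoint lead (D : nat) c p : Prop :=
  match D with
  | 0 => forall n, p n = c
  | D'.+1 => forall h h' : nat,
      lead D' (c *~ (h%:Z - h'%:Z)) (fun n => p (n + h)%N - p (n + h')%N)
  end.

Lemma eq_lead D c p p' : p =1 p' -> lead D c p -> lead D c p'.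
Proof.
elim: D c p p' => [|D IH] c p p' e /=; first by move=> h n; rewrite -e.
by move=> h a b; apply: IH (h a b) => n; rewrite !e.
Qed.

Lemma leadD D c c' p p' :
  lead D c p -> lead D c' p' -> lead D (c + c') (fun n => p n + p' n).
Proof.
elim: D c c' p p' => [|D IH] c c' p p' /=; first by move=> h h' n; rewrite h h'.
move=> h h' a b; rewrite mulrzDl; apply: eq_lead (IH _ _ _ _ (h a b) (h' a b)).
by move=> n; rewrite opprD addrACA.
Qed.

Lemma lead_scale D c p (z : int) : lead D c p -> lead D (c *~ z) (fun n => p n *~ z).
Proof.
elim: D c p => [|D IH] c p /=; first by move=> h n; rewrite h.
move=> h a b; rewrite mulrzAC; apply: eq_lead (IH _ _ (h a b)).
by move=> n; rewrite mulrzBl.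
Qed.

Lemma leadS0 D c p : lead D c p -> lead D.+1 0 p.
Proof.
elim: D c p => [|D IH] c p hp a b.
  by rewrite mul0rz => n; rewrite !hp subrr.
by rewrite mul0rz; apply: IH (hp a b).
Qed.

Lemma lead_lower D D' c p : (D < D')%N -> lead D c p -> lead D' 0 p.
Proof.
move=> /subnKC <-; elim: (D' - D.+1)%N => [|k IH] h.
  by rewrite addn0; apply: leadS0 h.
by rewrite addnS; apply: leadS0 (IH h).
Qed.

Lemma lead_sum0 D (I : Type) (r : seq I) (P : pred I) (f : I -> nat -> G) :
  (forall i, P i -> lead D 0 (f i)) -> lead D 0 (fun n => \sum_(i <- r | P i) f i n).
Proof.
have l0 : lead D (0 : G) (fun=> 0).
  elim: D => // D IH a b; rewrite mul0rz.
  by apply: eq_lead IH => n; rewrite subrr.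
move=> h; elim: r => [|i r IH]; first by apply: eq_lead l0 => n; rewrite big_nil.
case Pi: (P i).
  have := leadD (h i Pi) IH; rewrite addr0; apply: eq_lead => n.
  by rewrite big_cons Pi.
by apply: eq_lead IH => n; rewrite big_cons Pi.
Qed.

End PolynomialSequences.

Lemma lead_mulrz (G : zmodType) (c : G) D (z : int) (p : nat -> int) :
  lead D z p -> lead D (c *~ z) (fun n => c *~ p n).
Proof.
elim: D z p => [|D IH] z p /=; first by move=> h n; rewrite h.
move=> h a b; rewrite -mulrzA -mulrzz; apply: eq_lead (IH _ _ (h a b)).
by move=> n; rewrite mulrzBr.
Qed.

Lemma lead_exp (a r D : nat) :
  lead D (D`!%:Z * a%:Z ^+ D) (fun n => (a * n + r)%N%:Z ^+ D).
Proof.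
elim/ltn_ind: D => -[|D] IH; first by move=> n; rewrite !expr0 mulr1.
move=> h h' /=.
(* Binomial expansion around [a n + r]: the power [D.+1] cancels in the difference, the power [D]
   carries the leading term, and the lower powers have degree below [D]. *)
have split_top n : (a * (n + h) + r)%N%:Z ^+ D.+1 - (a * (n + h') + r)%N%:Z ^+ D.+1
  = (a * n + r)%N%:Z ^+ D *~ (D.+1%:Z * a%:Z * (h%:Z - h'%:Z)) +
    \sum_(i < D) (a * n + r)%N%:Z ^+ i *~
      (((a * h)%N%:Z ^+ (D.+1 - i) - (a * h')%N%:Z ^+ (D.+1 - i)) *+ 'C(D.+1, i)).
  have e k : (a * (n + k) + r)%N%:Z = (a * k)%N%:Z + (a * n + r)%N%:Z by lia.
  rewrite !e !exprDn -sumrB big_ord_recr big_ord_recr /= !subnn !expr0 !mul1r subrr addr0.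
  rewrite addrC; congr (_ + _).
    rewrite subSn // subnn !expr1 mulrzz -bin_sub // subSnn bin1 -mulrnBl -mulr_natr natz !PoszM.
    by ring.
  apply: eq_bigr => i _.
  by rewrite mulrzz -mulrnBl -mulrBl mulrnAr mulrC.
apply: (eq_lead (fun n => esym (split_top n))).
rewrite -[X in lead _ X _]addr0; apply: leadD.
  have := lead_scale (D.+1%:Z * a%:Z * (h%:Z - h'%:Z)) (IH D (ltnSn D)).
  by congr (lead _ _ _); rewrite mulrzz factS exprS -mulrzz PoszM; ring.
apply: lead_sum0 => i _; apply: lead_lower (ltn_ord i) _.
by apply: lead_scale; apply: IH; rewrite ltnS ltnW.
Qed.

Definition polyval (G : zmodType) (c : nat -> G) (D n : nat) : G :=
  \sum_(j < D.+1) c j *~ (n%:Z ^+ j).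

Lemma lead_polyval (G : zmodType) (c : nat -> G) D a r :
  lead D (c D *~ (D`!%:Z * a%:Z ^+ D)) (fun n => polyval c D (a * n + r)).
Proof.
have := leadD (lead_sum0 (index_enum 'I_D) (P := predT) (fun i _ =>
  lead_lower (ltn_ord i) (lead_mulrz (c i) (lead_exp a r i))))
  (lead_mulrz (c D) (lead_exp a r D)).
by rewrite add0r; apply: eq_lead => n; rewrite /polyval big_ord_recr.
Qed.

Section CoefficientLattice.
Variable G : zmodType.
Implicit Types (c : nat -> G) (x y : G).

(* The subgroup generated by the non-constant coefficients [c 1, ..., c D]. *)
Fixpoint lat (D : nat) c x : Prop :=
  match D with
  | 0 => x = 0
  | D'.+1 => exists z y, lat D' c y /\ x = y + c D *~ z
  end.

Definition scaled_lat D c (q : nat) x := exists2 y, lat D c y & x = y *+ q.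

Lemma lat0 D c : lat D c 0.
Proof. by elim: D => //= D IH; exists 0, 0; rewrite mulr0z addr0. Qed.

Lemma latD D c x y : lat D c x -> lat D c y -> lat D c (x + y).
Proof.
elim: D x y => [|D IH] x y /=; first by move=> -> ->; rewrite addr0.
move=> [z [x' [hx ->]]] [t [y' [hy ->]]]; exists (z + t), (x' + y'); split; first exact: IH.
by rewrite mulrzDr addrACA.
Qed.

Lemma latN D c x : lat D c x -> lat D c (- x).
Proof.
elim: D x => [|D IH] x /=; first by move=> ->; rewrite oppr0.
move=> [z [x' [hx ->]]]; exists (- z), (- x'); split; first exact: IH.
by rewrite mulrNz opprD.
Qed.

Lemma latMn D c x n : lat D c x -> lat D c (x *+ n).
Proof.
by move=> hx; elim: n => [|n IH]; [apply: lat0 | rewrite mulrS; apply: latD].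
Qed.

Lemma lat_le D c x : lat D c x -> lat D.+1 c x.
Proof. by move=> h; exists 0, x; rewrite mulr0z addr0. Qed.

Lemma lat_coef D c j : (0 < j <= D)%N -> lat D c (c j).
Proof.
elim: D => [|D IH]; first by case: j.
case/andP=> j0; rewrite leq_eqVlt => /predU1P[->|jD].
  by exists 1, 0; split; [apply: lat0 | rewrite add0r mulr1z].
by apply: lat_le; apply: IH; rewrite j0.
Qed.

Lemma lat_mulrn D c k x : lat D c x -> lat D (fun j => c j *+ k) (x *+ k).
Proof.
elim: D x => [|D IH] x /=; first by move=> ->; rewrite mul0rn.
move=> [z [y [hy ->]]]; exists z, (y *+ k); split; first exact: IH.
by rewrite mulrnDl !pmulrn mulrzAC.
Qed.

Lemma lat_mulrnE D c k x : lat D (fun j => c j *+ k) x -> exists y, x = y *+ k.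
Proof.
elim: D x => [|D IH] x /=; first by move=> ->; exists 0; rewrite mul0rn.
move=> [z [y [/IH[y' ->] ->]]]; exists (y' + c D.+1 *~ z).
by rewrite mulrnDl !pmulrn mulrzAC.
Qed.

Lemma polyval_mulrn c D k n : polyval (fun j => c j *+ k) D n = polyval c D n *+ k.
Proof.
by rewrite /polyval -sumrMnl; apply: eq_bigr => j _; rewrite !pmulrn mulrzAC.
Qed.

End CoefficientLattice.

(** * Isometric actions and van der Corput *)

Section SemiInnerProduct.
Variables (R : realType) (V : lmodType R) (ip : V -> V -> R).
Hypothesis ipC : forall x y, ip x y = ip y x.
Hypothesis ipDl : forall x y z, ip (x + y) z = ip x z + ip y z.
Hypothesis ipZl : forall a x z, ip (a *: x) z = a * ip x z.
Hypothesis ip_ge0 : forall x, 0 <= ip x x.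

Lemma ipDr x y z : ip x (y + z) = ip x y + ip x z.
Proof. by rewrite ipC ipDl !(ipC x). Qed.

Lemma ipZr a x y : ip x (a *: y) = a * ip x y.
Proof. by rewrite ipC ipZl ipC. Qed.

Lemma ipNl x y : ip (- x) y = - ip x y.
Proof. by rewrite -scaleN1r ipZl mulN1r. Qed.

Lemma ipNr x y : ip x (- y) = - ip x y.
Proof. by rewrite ipC ipNl ipC. Qed.

Lemma ip0l x : ip 0 x = 0.
Proof. by rewrite -(scale0r 0) ipZl mul0r. Qed.

Lemma ip_suml (I : Type) (r : seq I) (P : pred I) (F : I -> V) y :
  ip (\sum_(i <- r | P i) F i) y = \sum_(i <- r | P i) ip (F i) y.
Proof.
by apply: (big_morph (ip^~ y)) => [a b|]; rewrite ?ipDl ?ip0l.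
Qed.

Lemma ip_sumr (I : Type) (r : seq I) (P : pred I) (F : I -> V) y :
  ip y (\sum_(i <- r | P i) F i) = \sum_(i <- r | P i) ip y (F i).
Proof. by rewrite ipC ip_suml; apply: eq_bigr => i _; rewrite ipC. Qed.

Lemma ip_sqr x y : ip x y ^+ 2 <= ip x x * ip y y.
Proof.
have key t : 0 <= ip x x + 2 * t * ip x y + t ^+ 2 * ip y y.
  have := ip_ge0 (x + t *: y).
  by rewrite ipDl !ipDr !ipZl !ipZr (ipC y x); congr (_ <= _); ring.
have [y0|y0] := eqVneq (ip y y) 0.
  rewrite y0 mulr0; have [->|c0] := eqVneq (ip x y) 0; first by rewrite expr0n.
  (* The form is only semidefinite. For a null [y] the quadratic in [key] is affine in [t], and this
     [t] would give it the value -1. *)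
  have := key (- (ip x x + 1) / (2 * ip x y)); rewrite y0 mulr0 addr0.
  have -> : 2 * (- (ip x x + 1) / (2 * ip x y)) * ip x y = - (ip x x + 1) by field.
  lra.
have yp : 0 < ip y y by rewrite lt_neqAle eq_sym y0 ip_ge0.
have := key (- ip x y / ip y y).
have -> : ip x x + 2 * (- ip x y / ip y y) * ip x y + (- ip x y / ip y y) ^+ 2 * ip y y
  = ip x x - ip x y ^+ 2 / ip y y by field.
by rewrite subr_ge0 ler_pdivrMr.
Qed.

Definition nrm x := Num.sqrt (ip x x).

Lemma nrm_ge0 x : 0 <= nrm x. Proof. exact: sqrtr_ge0. Qed.
#[local] Hint Resolve nrm_ge0 : core.

Lemma nrm_sqr x : nrm x ^+ 2 = ip x x. Proof. by rewrite sqr_sqrtr. Qed.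

Lemma nrm_le x b : 0 <= b -> (nrm x <= b) = (ip x x <= b ^+ 2).
Proof. by move=> b0; rewrite -nrm_sqr ler_sqr ?nnegrE. Qed.

Lemma ip_le_nrm x y : `|ip x y| <= nrm x * nrm y.
Proof.
rewrite -ler_sqr ?nnegrE ?mulr_ge0 //.
by rewrite real_normK ?num_real // exprMn !nrm_sqr ip_sqr.
Qed.

Lemma nrmD x y : nrm (x + y) <= nrm x + nrm y.
Proof.
rewrite nrm_le ?addr_ge0 // ipDl !ipDr (ipC y x).
have := le_trans (ler_norm _) (ip_le_nrm x y).
have := nrm_sqr x; have := nrm_sqr y; nra.
Qed.

Lemma nrmZ a x : nrm (a *: x) = `|a| * nrm x.
Proof.
apply/eqP; rewrite -(@eqrXn2 _ 2) ?mulr_ge0 //.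
by rewrite exprMn !nrm_sqr ipZl ipZr mulrA -expr2 real_normK ?num_real.
Qed.

Lemma nrm0 : nrm 0 = 0. Proof. by rewrite /nrm ip0l sqrtr0. Qed.

Lemma nrmN x : nrm (- x) = nrm x.
Proof. by rewrite -scaleN1r nrmZ normrN1 mul1r. Qed.

Lemma nrmB x y : nrm (x - y) <= nrm x + nrm y.
Proof. by rewrite -(nrmN y) nrmD. Qed.

Lemma nrm_sum (I : Type) (r : seq I) (P : pred I) (F : I -> V) :
  nrm (\sum_(i <- r | P i) F i) <= \sum_(i <- r | P i) nrm (F i).
Proof.
elim/big_rec2: _ => [|i y x _ h]; first by rewrite nrm0.
by apply: le_trans (nrmD _ _) _; rewrite lerD2l.
Qed.

Lemma nrm_sum_le (M : nat) (u : nat -> V) b :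
  (forall n, nrm (u n) <= b) -> nrm (\sum_(n < M) u n) <= b * M%:R.
Proof.
move=> ub; apply: le_trans (nrm_sum _ _ _) _.
apply: (@le_trans _ _ (\sum_(n < M) b)); first by apply: ler_sum.
by rewrite sumr_const card_ord mulr_natr.
Qed.

(** Parallelogram law. It stands in for the projection to a shortest vector, which need not exist
    here. *)
Lemma near_shortest_close m eps x y : m <= ip (2^-1 *: (x + y)) (2^-1 *: (x + y)) ->
  ip x x <= m + eps -> ip y y <= m + eps -> ip (x - y) (x - y) <= 4 * eps.
Proof.
rewrite ipZl ipZr !(ipDl, ipDr, ipNl, ipNr) (ipC y x).
have -> : 2^-1 * (2^-1 * (ip x x + ip x y + (ip x y + ip y y))) =
  (ip x x + 2 * ip x y + ip y y) / 4 :> R by field.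
lra.
Qed.

Lemma ip_sum_le (M : nat) (v : nat -> V) :
  ip (\sum_(n < M) v n) (\sum_(n < M) v n) <= M%:R * \sum_(n < M) ip (v n) (v n).
Proof.
rewrite ip_suml.
have ineq (n m : nat) : ip (v n) (v m) <= (ip (v n) (v n) + ip (v m) (v m)) / 2.
  have := ip_ge0 (v n - v m).
  by rewrite !(ipDl, ipDr, ipNl, ipNr) (ipC (v m) (v n)); lra.
apply: (@le_trans _ _
  (\sum_(n < M) \sum_(m < M) (ip (v n) (v n) + ip (v m) (v m)) / 2)).
  by apply: ler_sum => n _; rewrite ip_sumr; apply: ler_sum => m _; apply: ineq.
under eq_bigr => n _ do rewrite -mulr_suml big_split /= sumr_const card_ord.
rewrite -mulr_suml big_split /= sumr_const card_ord sumrMnl.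
by set s := \sum_(i < M) _; rewrite -(mulr_natl s M); lra.
Qed.

(** Eventually small Cesaro averages, written without division. *)
Definition evs eps (u : nat -> V) :=
  exists M0 : nat, forall M : nat, (M0 <= M)%N -> nrm (\sum_(n < M) u n) <= eps * M%:R.

Lemma eq_evs eps u u' : u =1 u' -> evs eps u -> evs eps u'.
Proof.
by move=> e [M0 h]; exists M0 => M /h; under eq_bigr do rewrite e.
Qed.

Lemma evsD eps eps' u u' :
  evs eps u -> evs eps' u' -> evs (eps + eps') (fun n => u n + u' n).
Proof.
move=> [M0 h] [M1 h1]; exists (maxn M0 M1) => M; rewrite geq_max => /andP[/h {}h /h1 {}h1].
by rewrite big_split /= mulrDl; apply: le_trans (nrmD _ _) _; apply: lerD.
Qed.

Lemma evs_bound eps u : (forall n, nrm (u n) <= eps) -> evs eps u.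
Proof. by move=> h; exists 0%N => M _; apply: nrm_sum_le. Qed.

Lemma evsZ eps a u : evs eps u -> evs (`|a| * eps) (fun n => a *: u n).
Proof.
move=> [M0 h]; exists M0 => M /h {}h.
by rewrite -scaler_sumr nrmZ -mulrA ler_wpM2l.
Qed.

Lemma evs_le eps eps' u : eps <= eps' -> evs eps u -> evs eps' u.
Proof.
move=> le [M0 h]; exists M0 => M /h {}h; apply: le_trans h _.
by rewrite ler_wpM2r.
Qed.

Lemma evs_const_bound (K eps : R) (u : nat -> V) : 0 < eps ->
  (forall M : nat, nrm (\sum_(n < M) u n) <= K) -> evs eps u.
Proof.
move=> e0 h; have [N hN] := nat_upper_bound (K / eps).
exists N => M /hN; rewrite ler_pdivrMr // mulrC => hM.
exact: le_trans (h M) hM.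
Qed.

Lemma sum_shift_le (u : nat -> V) (b : R) (h M : nat) : (forall n, nrm (u n) <= b) ->
  nrm (\sum_(n < M) u (n + h)%N - \sum_(n < M) u n) <= 2 * b * h%:R.
Proof.
move=> ub; elim: h => [|h IH].
  under eq_bigr do rewrite addn0.
  by rewrite subrr nrm0 mulr0.
have e : \sum_(n < M) u (n + h.+1)%N = \sum_(n < M) u (n + h)%N + (u (M + h)%N - u h).
  elim: M {IH} => [|M IH]; first by rewrite !big_ord0 add0n subrr addr0.
  rewrite !big_ord_recr /= IH addnS addSn.
  by rewrite -!addrA [- _ + _]addrC.
rewrite e addrAC; apply: le_trans (nrmD _ _) _.
rewrite -[h.+1%:R]natr1 mulrDr mulr1; apply: lerD => //.
by apply: le_trans (nrmB _ _) _; have := ub (M + h)%N; have := ub h; lra.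
Qed.

(** Complete periods are split into residue classes modulo [q]; the incomplete one has fewer than
    [q] terms and is absorbed by [eta] for large [M]. *)
Lemma evs_residues eps eta b (q : nat) (u : nat -> V) : (0 < q)%N -> 0 < eta ->
  (forall n, nrm (u n) <= b) ->
  (forall r, (r < q)%N -> evs eps (fun n => u (q * n + r)%N)) -> evs (eps + eta) u.
Proof.
move=> q0 eta0 ub /eventually_forall_lt[M0 hM0].
have b0 : 0 <= b by apply: le_trans (nrm_ge0 _) (ub 0%N).
have eps0 : 0 <= eps.
  have := le_trans (nrm_ge0 _) (hM0 M0.+1 (leqnSn _) 0%N q0).
  by rewrite pmulr_lge0.
have [N hN] := nat_upper_bound (b * q%:R / eta).
exists (maxn N (q * M0)) => M; rewrite geq_max => /andP[/hN].
rewrite ler_pdivrMr // => hM1 hM2.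
have sumq K : \sum_(n < q * K) u n = \sum_(r < q) \sum_(n < K) u (q * n + r)%N.
  elim: K => [|K IH].
    by rewrite muln0 big_ord0 big1 // => r _; rewrite big_ord0.
  under [RHS]eq_bigr do rewrite big_ord_recr /=.
  rewrite big_split /= -IH mulnS addnC -(big_mkord xpredT) /=.
  rewrite (big_cat_nat (n := (q * K)%N)) ?leq_addr //= big_mkord; congr (_ + _).
  rewrite -{1}[(q * K)%N]add0n big_addn addKn big_mkord.
  by apply: eq_bigr => r _; rewrite addnC.
have dM := divn_eq M q; rewrite mulnC in dM.
rewrite dM -(big_mkord xpredT) /= (big_cat_nat (n := (q * (M %/ q))%N)) ?leq_addr //=.
rewrite big_mkord sumq -dM; apply: le_trans (nrmD _ _) _; rewrite mulrDl; apply: lerD.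
  apply: le_trans (nrm_sum _ _ _) _.
  apply: (@le_trans _ _ (\sum_(r < q) eps * (M %/ q)%:R)).
    by apply: ler_sum => r _; apply: hM0 => //; rewrite leq_divRL // mulnC.
  rewrite sumr_const card_ord -[(_ * _) *+ q]mulr_natl mulrCA -natrM ler_wpM2l // ler_nat.
  by rewrite mulnC leq_trunc_div.
rewrite -{1}[(q * _)%N]add0n big_addn big_mkord; 
apply: le_trans (nrm_sum_le _ (u := fun n => u (n + q * (M %/ q))%N) (fun n => ub _)) _.
apply: le_trans (_ : b * q%:R <= _); last by rewrite [eta * _]mulrC.
by rewrite ler_wpM2l // ler_nat leq_subLR {1}dM leq_add2l ltnW // ltn_mod.
Qed.

(** Up to an error bounded in [M], the sum of [u] is a sum of averages over windows of [H]
    consecutive terms. Expanding the squared norms of the window sums leaves diagonal pairs, which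
    are few, and correlations, which are small by assumption. *)
Lemma van_der_corput (gamma : R) (u : nat -> V) : 0 < gamma ->
  (forall n, nrm (u n) <= 2) ->
  (forall h h', h <> h' -> exists M0 : nat, forall M : nat, (M0 <= M)%N ->
     `|\sum_(n < M) ip (u (n + h)%N) (u (n + h')%N)| <= gamma ^+ 2 / 4 * M%:R) ->
  evs gamma u.
Proof.
move=> g0 ub cor; have g20 : 0 < gamma ^+ 2 by rewrite exprn_gt0.
(* With [H * gamma ^+ 2 >= 16] the diagonal contributes at most a quarter of [(gamma * H * M) ^+ 2],
   and the correlations another quarter. *)
have [H1 hH1] := nat_upper_bound (16 / gamma ^+ 2).
set H := H1.+1; have {hH1} := hH1 H (leqnSn H1); rewrite ler_pdivrMr // => hH.
have H0 : 0 < H%:R :> R by rewrite ltr0n.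
have [M1 hM1] : exists M1, forall M, (M1 <= M)%N -> forall h, (h < H)%N ->
    forall h', (h' < H)%N -> h <> h' ->
    `|\sum_(n < M) ip (u (n + h)%N) (u (n + h')%N)| <= gamma ^+ 2 / 4 * M%:R.
  apply: eventually_forall_lt => h _.
  apply: (eventually_forall_lt (Q := fun h' M => h <> h' ->
    `|\sum_(n < M) ip (u (n + h)%N) (u (n + h')%N)| <= gamma ^+ 2 / 4 * M%:R)) => h' _.
  have [->|/eqP/cor[M0 hM0]] := eqVneq h h'; first by exists 0%N.
  by exists M0 => M /hM0.
have [M2 hM2] := nat_upper_bound (4 * H%:R / (gamma / 4)).
exists (maxn M1 M2) => M; rewrite geq_max => /andP[/hM1 {}hM1 /hM2].
rewrite ler_pdivrMr ?divr_gt0 // => {}hM2.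
have M0 : 0 <= M%:R :> R by [].
pose v n := \sum_(h < H) u (n + h)%N.
(* The square of [3 / 4] exceeds the two quarters; the remaining [gamma / 4] pays for the shifts in
   [dle]. *)
have vle : nrm (\sum_(n < M) v n) <= 3 / 4 * gamma * H%:R * M%:R.
  rewrite nrm_le ?mulr_ge0 ?divr_ge0 ?(ltW g0) //.
  apply: le_trans (ip_sum_le _ _) _.
  have -> : \sum_(n < M) ip (v n) (v n) =
    \sum_(h < H) \sum_(h' < H) \sum_(n < M) ip (u (n + h)%N) (u (n + h')%N).
    under eq_bigr => n _.
      rewrite ip_suml; under eq_bigr => h _ do rewrite ip_sumr.
      over.
    by rewrite exchange_big /=; apply: eq_bigr => h _; rewrite exchange_big.
  have : \sum_(h < H) \sum_(h' < H) \sum_(n < M) ip (u (n + h)%N) (u (n + h')%N)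
      <= \sum_(h < H) (4 * M%:R + H%:R * (gamma ^+ 2 / 4 * M%:R)).
    apply: ler_sum => h _; rewrite (bigD1 h) //=; apply: lerD.
      rewrite mulr_natr -[X in _ <= _ *+ X]card_ord -sumr_const.
      apply: ler_sum => n _; rewrite -nrm_sqr.
      have := ub (n + h)%N; have := nrm_ge0 (u (n + h)%N); nra.
    apply: (@le_trans _ _ (\sum_(h' < H | h' != h) gamma ^+ 2 / 4 * M%:R)).
      apply: ler_sum => h' hh'; apply: le_trans (ler_norm _) _; apply: hM1 => // e.
      by move/eqP: hh'; apply; apply: val_inj.
    rewrite mulr_natl sumr_const; apply: ler_wpMn2l.
      by rewrite mulr_ge0 // divr_ge0 // ltW.
    by apply: leq_trans (max_card _) _; rewrite card_ord.
  rewrite sumr_const card_ord -[(_ + _) *+ H]mulr_natl => hs.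
  apply: le_trans (ler_wpM2l M0 hs) _.
  have -> : (3 / 4 * gamma * H%:R * M%:R) ^+ 2 =
     (M%:R ^+ 2 * H%:R) * (9 / 16 * (H%:R * gamma ^+ 2)) :> R by field.
  set g := gamma ^+ 2 in g20 hH *.
  have -> : M%:R * (H%:R * (4 * M%:R + H%:R * (g / 4 * M%:R))) =
     (M%:R ^+ 2 * H%:R) * (4 + H%:R * g / 4) :> R by ring.
  apply: ler_wpM2l; first by rewrite mulr_ge0 // exprn_ge0.
  lra.
have dle : nrm (H%:R *: \sum_(n < M) u n - \sum_(n < M) v n) <= 4 * H%:R * H%:R.
  rewrite /v exchange_big /= scaler_nat -[X in _ *+ X]card_ord -sumr_const -sumrB.
  apply: le_trans (nrm_sum _ _ _) _.
  apply: (@le_trans _ _ (\sum_(h < H) 4 * H%:R)); last first.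
    by rewrite sumr_const card_ord -[(_ * _) *+ H]mulr_natr.
  apply: ler_sum => h _; rewrite -nrmN opprB.
  apply: le_trans (sum_shift_le h M ub) _.
  have : (h%:R : R) <= H%:R by rewrite ler_nat ltnW.
  lra.
have : nrm (H%:R *: \sum_(n < M) u n) <= H%:R * (gamma * M%:R).
  have {1}-> : H%:R *: \sum_(n < M) u n =
    (H%:R *: \sum_(n < M) u n - \sum_(n < M) v n) + \sum_(n < M) v n by rewrite subrK.
  apply: le_trans (nrmD _ _) _.
  apply: le_trans (lerD dle vle) _.
  have : 4 * H%:R * H%:R <= M%:R * (gamma / 4) * H%:R by rewrite ler_wpM2r // ltW.
  lra.
by rewrite nrmZ ger0_norm // ler_pM2l.
Qed.

(** * Averages of translates, and van der Corput along polynomials *)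

Section Action.
Variables (G : zmodType) (T : G -> V -> V).
Hypothesis TD : forall g x y, T g (x + y) = T g x + T g y.
Hypothesis TZ : forall g a x, T g (a *: x) = a *: T g x.
Hypothesis T0 : forall x, T 0 x = x.
Hypothesis TM : forall g h x, T (g + h) x = T g (T h x).
Hypothesis ipT : forall g x y, ip (T g x) (T g y) = ip x y.

Lemma TN g x : T g (- x) = - T g x.
Proof. by rewrite -scaleN1r TZ scaleN1r. Qed.

Lemma TB g x y : T g (x - y) = T g x - T g y.
Proof. by rewrite TD TN. Qed.

Lemma T_sum g (I : Type) (r : seq I) (P : pred I) (F : I -> V) :
  T g (\sum_(i <- r | P i) F i) = \sum_(i <- r | P i) T g (F i).
Proof.
apply: (big_morph (T g)) => [a b|]; first exact: TD.
by have := TZ g 0 0; rewrite !scale0r.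
Qed.

Lemma TK g x : T g (T (- g) x) = x.
Proof. by rewrite -TM subrr T0. Qed.

Lemma T_comm g h x : T g (T h x) = T h (T g x).
Proof. by rewrite -!TM addrC. Qed.

Lemma nrmT g x : nrm (T g x) = nrm x.
Proof. by rewrite /nrm ipT. Qed.

Lemma ipTN g x y : ip (T g x) y = ip x (T (- g) y).
Proof. by rewrite -{1}(TK g y) ipT. Qed.

(** Convex combinations of translations by elements of [S], with dyadic weights. Midpoints suffice
    for the parallelogram law, and they turn each property into an induction. *)
Inductive Avg (S : G -> Prop) : (V -> V) -> Prop :=
| Avg_base g : S g -> Avg S (T g)
| Avg_mid A B : Avg S A -> Avg S B -> Avg S (fun x => 2^-1 *: (A x + B x)).

Lemma half_dup (x : V) : 2^-1 *: (x + x) = x.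
Proof. by rewrite -mulr2n -[x *+ 2]scaler_nat scalerA mulVf ?scale1r // pnatr_eq0. Qed.

Lemma Avg_mono (S S' : G -> Prop) A : (forall g, S g -> S' g) -> Avg S A -> Avg S' A.
Proof.
by move=> SS; elim=> [g /SS|B C _ hB _ hC]; [apply: Avg_base | apply: Avg_mid].
Qed.

Lemma AvgD S A x y : Avg S A -> A (x + y) = A x + A y.
Proof.
move=> hA; elim: hA x y => [g _ x y|B C _ hB _ hC x y]; first exact: TD.
by rewrite hB hC -scalerDr; congr (_ *: _); rewrite addrACA.
Qed.

Lemma AvgZ S A a x : Avg S A -> A (a *: x) = a *: A x.
Proof.
move=> hA; elim: hA x => [g _ x|B C _ hB _ hC x]; first exact: TZ.
by rewrite hB hC -scalerDr !scalerA mulrC.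
Qed.

Lemma AvgB S A x y : Avg S A -> A (x - y) = A x - A y.
Proof. by move=> hA; rewrite (AvgD _ _ hA) -scaleN1r (AvgZ _ _ hA) scaleN1r. Qed.

Lemma Avg_T S A g x : Avg S A -> A (T g x) = T g (A x).
Proof.
move=> hA; elim: hA x => [h _ x|B C _ hB _ hC x]; first exact: T_comm.
by rewrite hB hC TZ TD.
Qed.

Lemma Avg_comm S S' A B x : Avg S A -> Avg S' B -> A (B x) = B (A x).
Proof.
move=> hA hB; elim: hB x => [h _ x|C D _ hC _ hD x]; first by rewrite (Avg_T _ _ hA).
by rewrite (AvgZ _ _ hA) (AvgD _ _ hA) hC hD.
Qed.

Lemma nrm_half x y b : nrm x <= b -> nrm y <= b -> nrm (2^-1 *: (x + y)) <= b.
Proof.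
move=> xb yb; rewrite nrmZ ger0_norm ?invr_ge0 //.
by have := nrmD x y; lra.
Qed.

Lemma nrm_Avg S A x : Avg S A -> nrm (A x) <= nrm x.
Proof.
by elim=> [g _|B C _ hB _ hC]; [rewrite nrmT | apply: nrm_half].
Qed.

Lemma Avg_comp (S : G -> Prop) A B : (forall g h, S g -> S h -> S (g + h)) ->
  Avg S A -> Avg S B -> Avg S (fun x => A (B x)).
Proof.
move=> Sadd hA; elim: hA B => [g Sg B hB|A1 A2 _ h1 _ h2 B hB]; last first.
  by apply: Avg_mid; [apply: h1 | apply: h2].
elim: hB => [h Sh|B1 B2 _ h1 _ h2].
  rewrite (_ : (fun x => _) = T (g + h)); first by apply: Avg_base; apply: Sadd.
  by apply: funext => x; rewrite TM.
have := Avg_mid h1 h2; congr (Avg _ _).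
by apply: funext => x; rewrite TZ TD.
Qed.

Definition mult (c g : G) := exists z : int, g = c *~ z.

Lemma multD c g h : mult c g -> mult c h -> mult c (g + h).
Proof. by move=> [z ->] [z' ->]; exists (z + z'); rewrite mulrzDr. Qed.

(** Applying [T (c *+ k)] shifts the index by [k] along the progression [p], so the sums for
    [w - T (c *+ k) w] telescope and stay bounded; midpoints then give a general [A]. *)
Lemma evs_linear_coboundary (c : G) (p : nat -> G) A w eta : 0 < eta ->
  (forall n, p n.+1 = p n + c) -> Avg (mult c) A ->
  evs eta (fun n => T (p n) (w - A w)).
Proof.
move=> eta0 hp; have pD n k : p (n + k)%N = p n + c *+ k.
  by elim: k => [|k IH]; rewrite ?addn0 ?mulr0n ?addr0 // addnS hp IH mulrSr addrA.
have pos (k : nat) x eta' : 0 < eta' -> evs eta' (fun n => T (p n) (x - T (c *+ k) x)).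
  move=> e0; apply: (evs_const_bound (K := 2 * nrm x * k%:R)) => // M.
  rewrite -nrmN; under eq_bigr => n _ do rewrite TB -TM -pD.
  rewrite sumrB opprB.
  by apply: (sum_shift_le (u := fun n => T (p n) x)) => n; rewrite nrmT.
move=> hA; elim: hA eta eta0 => [_ [z ->]|B C _ hB _ hC] eta eta0.
  case: z => k; first exact: pos.
  (* A negative multiple: for [x = T (c *~ Negz k) w], the vector [w - x] is the opposite of
     [x - T (c *+ k.+1) x]. *)
  have := evsZ (-1) (pos k.+1 (T (c *~ Negz k) w) _ eta0).
  rewrite normrN1 mul1r; apply: eq_evs => n.
  rewrite -TZ; congr (T _ _); rewrite -TM NegzE mulrNz -pmulrn subrr T0.
  by rewrite scaleN1r opprB.
have := evsZ 2^-1 (evsD (hB _ eta0) (hC _ eta0)).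
have -> : `|2^-1| * (eta + eta) = eta :> R.
  by rewrite ger0_norm ?invr_ge0 //; field.
apply: eq_evs => n; rewrite -TD -TZ; congr (T _ _).
by rewrite -[X in _ = X - _](half_dup w) -scalerBr; congr (_ *: _); rewrite opprD addrACA.
Qed.

(* Approximate total ergodicity of [w] in the direction [c]. *)
Definition toterg eps c w :=
  forall z : int, z != 0 -> exists2 A, Avg (mult (c *~ z)) A & nrm (A w) <= eps.

(** Induction on the degree. In degree one [w - A w] telescopes and [A w] is small. Beyond, the
    correlations in van der Corput's inequality pair [w] with sums along differences of [p], which
    have lower degree and again a nonzero multiple of [c] as leading term. The threshold [eps]
    depends on [D] and [gamma] only. *)
Lemma toterg_evs (D : nat) (gamma : R) : 0 < gamma -> exists2 eps, 0 < eps &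
  forall w c, nrm w <= 2 -> toterg eps c w ->
  forall p (z : int), z != 0 -> lead D.+1 (c *~ z) p -> evs gamma (fun n => T (p n) w).
Proof.
elim: D gamma => [|D IH] gamma g0.
  exists (gamma / 2); first by rewrite divr_gt0.
  move=> w c w2 wt p z z0 hp; have [A hA Aw] := wt z z0.
  have hS n : p n.+1 = p n + c *~ z.
    have := hp 1%N 0%N n; rewrite addn1 addn0 subr0 mulr1z => <-.
    by rewrite addrC subrK.
  have g2 : 0 < gamma / 2 by rewrite divr_gt0.
  have := evsD (evs_linear_coboundary w g2 hS hA)
    (evs_bound (u := fun n => T (p n) (A w)) (fun n => eq_ind_r (fun x => x <= _) Aw (nrmT (p n) _))).
  rewrite -splitr; apply: eq_evs => n.
  by rewrite -TD subrK.
(* Van der Corput's inequality asks for [gamma ^+ 2 / 4], and pairing with [w] costs a factor 2. *)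
have g8 : 0 < gamma ^+ 2 / 8 by rewrite divr_gt0 // exprn_gt0.
have [eps e0 heps] := IH _ g8.
exists eps => // w c w2 wt p z z0 hp; apply: van_der_corput => // [n|h h' hh'].
  by rewrite nrmT.
have zh : z * (h%:Z - h'%:Z) != 0.
  rewrite mulf_neq0 // subr_eq0; apply/eqP => -[]; exact: hh'.
have hd : lead D.+1 (c *~ (z * (h%:Z - h'%:Z))) (fun n => p (n + h)%N - p (n + h')%N).
  by rewrite mulrzA; apply: hp.
have [M0 hM0] := heps w c w2 wt _ _ zh hd.
exists M0 => M /hM0 {}hM0.
have -> : \sum_(n < M) ip (T (p (n + h)%N) w) (T (p (n + h')%N) w) =
    ip (\sum_(n < M) T (p (n + h)%N - p (n + h')%N) w) w.
  rewrite ip_suml; apply: eq_bigr => n _.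
  by rewrite [in RHS]addrC TM [RHS]ipTN opprK.
apply: le_trans (ip_le_nrm _ _) _.
have M0' : 0 <= M%:R :> R by [].
apply: le_trans (ler_pM _ _ hM0 w2) _ => //.
lra.
Qed.

Lemma Avg_near_minimal (S : nat -> G -> Prop) e eps :
  nrm e <= 1 -> 0 < eps -> (forall q, S q 0) ->
  (forall q q', (0 < q)%N -> (0 < q')%N -> forall g, S (q * q')%N g -> S q g) ->
  exists q m, [/\ (0 < q)%N,
    forall A, Avg (S q) A -> m <= ip (A e) (A e) &
    forall q', (0 < q')%N -> exists2 A, Avg (S (q * q')%N) A & ip (A e) (A e) <= m + eps].
Proof.
move=> e1 eps0 S0 Smul.
pose Phi q : set R := fun x => exists2 A, Avg (S q) A & x = ip (A e) (A e).
have [||||q [m [q0 hm hq]]] := @near_minimal_scale R Phi eps.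
- by [].
- by move=> q; exists (ip e e), (T 0); rewrite ?T0 //; apply: Avg_base.
- move=> q _ [A hA ->]; rewrite ip_ge0 -nrm_sqr.
  have := le_trans (nrm_Avg e hA) e1; have := nrm_ge0 (A e); nra.
- move=> q q' q0 q'0 _ [A hA ->]; exists A => //.
  by apply: Avg_mono hA => g; apply: Smul.
exists q, m; split=> // [A hA|q' /hq[_ [A hA ->] h]]; first by apply: hm; exists A.
by exists A.
Qed.

Lemma near_minimal_close S e m eps A B : 0 <= eps ->
  (forall A, Avg S A -> m <= ip (A e) (A e)) -> Avg S A -> Avg S B ->
  ip (A e) (A e) <= m + eps ^+ 2 / 4 -> ip (B e) (B e) <= m + eps ^+ 2 / 4 ->
  nrm (A e - B e) <= eps.
Proof.
move=> eps0 hm hA hB Ae Be; rewrite nrm_le //.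
apply: le_trans (near_shortest_close (hm _ (Avg_mid hA hB)) Ae Be) _.
lra.
Qed.

(** [A1 e] is an almost shortest vector of the hull of [e] under multiples of [c *+ q]; its
    translates by such multiples are others, hence close to it. For total ergodicity, take an [A]
    over a finer subgroup with [A e] almost shortest: [A (A1 e)] is no longer than [A1 e], so it is
    close to [A e]. *)
Lemma direction_splitting e c eps : nrm e <= 1 -> 0 < eps ->
  exists q A1, [/\ (0 < q)%N, Avg (mult (c *+ q)) A1, toterg eps c (e - A1 e) &
    forall z : int, nrm (T (c *+ q *~ z) (A1 e) - A1 e) <= eps].
Proof.
move=> e1 eps0; have eps4 : 0 < eps ^+ 2 / 4 by rewrite divr_gt0 // exprn_gt0.
have [||q [m [q0 hm hq]]] := @Avg_near_minimal (fun q => mult (c *+ q)) e _ e1 eps4.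
- by move=> q; exists 0; rewrite mulr0z.
- by move=> q q' _ _ _ [z ->]; exists (q'%:Z * z); rewrite mulrzA -pmulrn mulrnA.
have [A1 hA1 A1e] := hq 1%N isT; rewrite muln1 in hA1.
exists q, A1; split=> // [z z0|z].
  have [|A hA Ae] := hq `|z|%N; first by rewrite absz_gt0.
  have hA' : Avg (mult (c *+ q)) A.
    by apply: Avg_mono hA => _ [y ->]; exists (`|z|%N%:Z * y); rewrite mulrzA -pmulrn mulrnA.
  exists A.
    apply: Avg_mono hA => _ [y ->]; exists (Num.sg z * q%:Z * y).
    rewrite -!mulrzA pmulrn -mulrzA; congr (_ *~ _).
    rewrite PoszM abszE [in RHS]mulrA [in RHS]mulrA [z * _]mulrC -normrEsg.
    by rewrite [_ * q%:Z]mulrC.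
  rewrite (AvgB _ _ hA).
  apply: (near_minimal_close (S := mult (c *+ q)) (m := m) (B := fun x => A (A1 x)) (ltW eps0)) => //.
    by apply: Avg_comp => //; apply: multD.
  apply: le_trans A1e; rewrite -!nrm_sqr ler_sqr ?nnegrE //.
  exact: nrm_Avg hA.
apply: (near_minimal_close (S := mult (c *+ q)) (m := m) (A := fun x => T _ (A1 x)) (ltW eps0)) => //.
  apply: (Avg_comp (A := T _)) => //; first exact: multD.
  by apply: Avg_base; exists z.
by rewrite ipT.
Qed.

Lemma evsT g eps u : evs eps u -> evs eps (fun n => T g (u n)).
Proof. by move=> [M0 h]; exists M0 => M /h; rewrite -T_sum nrmT. Qed.

Lemma Avg_drop_direction (D : nat) (c : nat -> G) (q1 q2 : nat) eps x A' :
  (forall z : int, nrm (T (c D.+1 *+ q1 *~ z) x - x) <= eps) ->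
  Avg (scaled_lat D.+1 c (q1 * q2)) A' ->
  exists2 A, Avg (scaled_lat D c (q1 * q2)) A & nrm (A' x - A x) <= eps.
Proof.
move=> inv; elim=> [_ [_ [z [y [hy ->]]] ->]|A B _ [A1 hA1 A1x] _ [B1 hB1 B1x]].
  exists (T (y *+ (q1 * q2))); first by apply: Avg_base; exists y.
  rewrite mulrnDl TM -TB nrmT.
  have -> : c D.+1 *~ z *+ (q1 * q2) = c D.+1 *+ q1 *~ (z * q2%:Z).
    by rewrite !pmulrn -!mulrzA; congr (_ *~ _); rewrite PoszM; ring.
  exact: inv.
exists (fun x => 2^-1 *: (A1 x + B1 x)); first exact: Avg_mid.
by rewrite -scalerBr opprD addrACA nrm_half.
Qed.

(* The top coefficient is treated first: [e] is split into a part which is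
   totally ergodic in its direction, killed by van der Corput, and an almost
   invariant part, for which the top coefficient disappears along progressions. *)
Lemma polynomial_averages D eps e (c : nat -> G) : 0 < eps -> nrm e <= 1 ->
  exists q A0, [/\ (0 < q)%N, Avg (lat D c) A0 &
    forall A', Avg (scaled_lat D c q) A' -> forall a r, (0 < a)%N ->
    evs eps (fun n => T (polyval c D (a * n + r)) (e - A' (A0 e)))].
Proof.
elim: D eps e => [|D IH] eps e eps0 e1.
  exists 1%N, (T 0); split=> //; first exact: Avg_base.
  move=> A' hA' a r _; apply: evs_bound => n.
  have -> : A' (T 0 e) = e; last by rewrite subrr nrmT nrm0 ltW.
  rewrite T0; elim: hA' => [_ [_ -> ->]|A B _ -> _ ->]; last exact: half_dup.
  by rewrite mul0rn T0.
have eps4 : 0 < eps / 4 by lra.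
have [eps' eps'0 hev] := toterg_evs D eps4.
(* At most [eps'] for the use of [toterg_evs], and at most [eps / 32] so that the final error
   [5 / 8 * eps + 3 * d] stays below [eps]. *)
set d := Num.min eps' (eps / 32).
have d0 : 0 < d by rewrite lt_min eps'0; lra.
have dle' : d <= eps' by rewrite ge_min lexx.
have dle : d <= eps / 32 by rewrite ge_min lexx orbT.
have [q1 [A1 [q10 hA1 te inv]]] := direction_splitting (c D.+1) e1 d0.
set x := A1 e in te inv *.
have x1 : nrm x <= 1 by apply: le_trans (nrm_Avg _ hA1) e1.
have [q2 [A2 [q20 hA2 h2]]] := IH _ _ eps4 x1.
exists (q1 * q2)%N, (fun v => A2 (A1 v)); split; first by rewrite muln_gt0 q10.
  apply: Avg_comp; first exact: latD.
    by apply: Avg_mono hA2 => g; apply: lat_le.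
  by apply: Avg_mono hA1 => _ [z ->]; exists (q1%:Z * z), 0; split;
    [apply: lat0 | rewrite add0r mulrzA -pmulrn].
move=> A' hA' a r a0; rewrite -/x.
have [A'' hA'' dA] := Avg_drop_direction inv hA'.
have hA''2 : Avg (scaled_lat D c q2) A''.
  by apply: Avg_mono hA'' => _ [y hy ->]; exists (y *+ q1); rewrite ?mulrnA //; apply: latMn.
(* [e - A' (A2 x)] is cut into [e - x], totally ergodic along the top coefficient,
   [y = x - A'' (A2 x)], almost invariant under multiples of [c D.+1 *+ q1], and a uniformly small
   rest. *)
have ev1 : evs (eps / 4) (fun n => T (polyval c D.+1 (a * n + r)) (e - x)).
  apply: (hev _ (c D.+1) _ _ _ ((D.+1)`!%:Z * a%:Z ^+ D.+1)).
  - by apply: le_trans (nrmB _ _) _; lra.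
  - by move=> z /te[A hA hAe]; exists A => //; apply: le_trans hAe _.
  - by rewrite mulf_neq0 // ?expf_neq0 // -?lt0n ?fact_gt0 //; apply: lt0r_neq0.
  - exact: lead_polyval.
have ev3 : evs d (fun n => T (polyval c D.+1 (a * n + r)) (A'' (A2 x) - A' (A2 x))).
  apply: evs_bound => n; rewrite nrmT (Avg_comm _ hA'' hA2) (Avg_comm _ hA' hA2).
  rewrite -(AvgB _ _ hA2); apply: le_trans (nrm_Avg _ hA2) _.
  by rewrite -nrmN opprB.
set y := x - A'' (A2 x).
have y2 : nrm y <= 2.
  apply: le_trans (nrmB _ _) _.
  have := le_trans (nrm_Avg (A2 x) hA'') (nrm_Avg x hA2); lra.
have yinv z : nrm (T (c D.+1 *+ q1 *~ z) y - y) <= 2 * d.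
  set t := T _ y - y.
  have -> : t = (T (c D.+1 *+ q1 *~ z) x - x) - A'' (A2 (T (c D.+1 *+ q1 *~ z) x - x)).
    rewrite (AvgB _ _ hA2) (AvgB _ _ hA'') (Avg_T _ _ hA2) (Avg_T _ _ hA'').
    by rewrite /t /y TB !opprB addrACA [RHS]addrACA; congr (_ + _); rewrite addrC.
  apply: le_trans (nrmB _ _) _.
  have := inv z; have := nrm_Avg (T (c D.+1 *+ q1 *~ z) x - x) hA2.
  have := nrm_Avg (A2 (T (c D.+1 *+ q1 *~ z) x - x)) hA''; lra.
have ev2 : evs (eps / 4 + 2 * d + eps / 8) (fun n => T (polyval c D.+1 (a * n + r)) y).
  apply: (evs_residues (b := 2) q10); [lra|by move=> n; rewrite nrmT|].
  move=> r' _; set s := (a * r' + r)%N.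
  (* On a residue class modulo [q1] the top power is constant modulo [q1], so by [yinv] the top
     coefficient acts on [y] almost as a fixed translation. The induction hypothesis handles the
     rest along the progression [a * q1 * n + s]. *)
  have [Z hZ] : exists Z : nat -> int, forall n,
      (a * (q1 * n + r') + r)%N%:Z ^+ D.+1 = s%:Z ^+ D.+1 + q1%:Z * Z n.
    exists (fun n => (a * n)%N%:Z *
      \sum_(i < D.+1) (a * (q1 * n + r') + r)%N%:Z ^+ (D - i) * s%:Z ^+ i) => n.
    apply/eqP; rewrite addrC -subr_eq; apply/eqP; rewrite subrXX mulrA; congr (_ * _).
    by rewrite /s; lia.
  have ev := evsT (c D.+1 *~ s%:Z ^+ D.+1) (h2 _ hA''2 (a * q1)%N s _).
  have {}ev := ev _; rewrite muln_gt0 a0 q10 in ev; have {}ev := ev isT.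
  have evb := evs_bound (u := fun n => T (c D.+1 *~ s%:Z ^+ D.+1 + polyval c D (a * q1 * n + s))
    (T (c D.+1 *+ q1 *~ Z n) y - y)) (fun n => eq_ind_r (fun v => v <= _) (yinv (Z n)) (nrmT _ _)).
  apply: eq_evs (evsD ev evb) => n.
  rewrite -TM -/y -TD subrKC -TM; congr (T _ _).
  rewrite /polyval [in RHS]big_ord_recr /= hZ mulrzDr [RHS]addrCA -addrA; congr (_ + (_ + _)).
    by rewrite /s mulnDr mulnA addnA.
  by rewrite pmulrn mulrzA.
apply: (evs_le _ (eq_evs _ (evsD ev1 (evsD ev2 ev3)))) => [|n]; first lra.
by rewrite -!TD /y; congr (T _ _); rewrite addrA !subrKA.
Qed.

(** The hull of [e] under multiples of [k] is nearly minimal; this concerns [e] alone, so [k] is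
    fixed before [D] and [c]. By the hypothesis on [c], the finer lattice coming from
    [polynomial_averages] still contains, as far as [T] can tell, a whole multiple of [G], over
    which almost shortest vectors exist. *)
Theorem uniform_polynomial_recurrence e (delta : R) : nrm e <= 1 -> 0 < delta ->
  (forall A, Avg (fun=> True) A -> delta <= ip (A e) (A e)) ->
  exists2 k, (0 < k)%N & forall D (c : nat -> G),
    (forall g, exists2 y, lat D c y & T g = T y) ->
    exists n, 0 < ip e (T (polyval c D n *+ k) e).
Proof.
move=> e1 d0 hd; set eps := delta / 4; have eps0 : 0 < eps by rewrite /eps; lra.
pose S (q : nat) (g : G) := exists y, g = y *+ q.
have SD q g h : S q g -> S q h -> S q (g + h).
  by move=> [y ->] [z ->]; exists (y + z); rewrite mulrnDl.
have eps4 : 0 < eps ^+ 2 / 4 by rewrite divr_gt0 // exprn_gt0.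
have [||k [m [k0 hm hk]]] := @Avg_near_minimal S e _ e1 eps4.
- by move=> q; exists 0; rewrite mul0rn.
- by move=> q q' _ _ g [y ->]; exists (y *+ q'); rewrite mulnC mulrnA.
exists k => // D c full; pose ck j := c j *+ k.
have [q [A0 [q0 hA0 hev]]] := polynomial_averages D ck eps0 e1.
have [A' hA' A'e] := hk q q0.
have {}hA' : Avg (scaled_lat D ck q) A'.
  elim: hA' => [g [y ->]|A B _ hA _ hB]; last exact: Avg_mid.
  have [y' hy' yy'] := full y.
  have TMn z z' n : T z = T z' -> T (z *+ n) = T (z' *+ n).
    move=> zz; elim: n => [|n IH]; first by rewrite !mulr0n.
    by apply: funext => v; rewrite !mulrS !TM IH zz.
  rewrite (TMn _ _ _ yy'); apply: Avg_base; exists (y' *+ k); last by rewrite mulrnA.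
  exact: lat_mulrn.
have latS g : lat D ck g -> S k g by move=> /lat_mulrnE.
have hA'k : Avg (S k) A'.
  by apply: Avg_mono hA' => _ [y /latS[z ->] ->]; exists (z *+ q); rewrite mulrnAC.
have hA0k : Avg (S k) A0 by apply: Avg_mono hA0 => g /latS.
have [M0 hM0] := hev A' hA' 1%N 0%N isT.
set h := A' (A0 e) in hM0.
have hh : ip h h <= m + eps ^+ 2 / 4.
  rewrite /h (Avg_comm _ hA' hA0); apply: le_trans A'e.
  by rewrite -!nrm_sqr ler_sqr ?nnegrE // (nrm_Avg _ hA0).
(* An almost shortest vector of the hull pairs with [e] almost as with itself. *)
have pairing g : S k g -> delta - eps <= ip e (T g h).
  move=> Sg; pose X v := T g (A' (A0 v)); have hX : Avg (S k) X.
    apply: (Avg_comp (A := T g) (SD k)); first exact: Avg_base.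
    exact: Avg_comp (SD k) _ _.
  have Xe : ip (X e) (X e) <= m + eps ^+ 2 / 4 by rewrite /X ipT.
  (* Replacing [e] by an average [A e] costs at most [eps]: [T f] moves to the other side, where
     [T (- f)] produces another almost shortest vector. The case [A = X] is the one used. *)
  have close A : Avg (S k) A -> ip (A e) (X e) - ip e (X e) <= eps.
    elim=> [f Sf|B C _ hB _ hC]; last by rewrite ipZl ipDl; lra.
    rewrite ipTN -ipNr -ipDr; apply: le_trans (ler_norm _) _.
    apply: le_trans (ip_le_nrm _ _) _; rewrite -[leRHS]mul1r; apply: ler_pM => //.
    apply: (near_minimal_close (S := S k) (A := fun v => T (- f) (X v)) (ltW eps0) hm) => //.
      apply: (Avg_comp (A := T (- f)) (SD k)) => //; apply: Avg_base.
      by case: Sf => y ->; exists (- y); rewrite mulNrn.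
    by rewrite ipT.
  have := close X hX.
  have : delta <= ip (X e) (X e) by apply: hd; apply: Avg_mono hX.
  rewrite /X -/h; lra.
(* Otherwise every term pairs with [e] to at most [- (delta - eps) = - 3 * eps], whereas their
   average has norm at most [eps]. *)
apply: contrapT => /forallNP none.
pose M := M0.+1; have := hM0 M (leqnSn M0); have Mp : 0 < M%:R :> R by rewrite ltr0n.
set s := \sum_(n < M) _ => hs.
have : `|ip e s| <= eps * M%:R.
  apply: le_trans (ip_le_nrm _ _) _; rewrite -[leRHS]mul1r; apply: ler_pM => //.
rewrite ler_norml => /andP[hlow _].
have : ip e s <= \sum_(n < M) (- (delta - eps)).
  rewrite /s ip_sumr; apply: ler_sum => n _; rewrite mul1n addn0 TB ipDr ipNr.
  have := none n; rewrite polyval_mulrn => /negP; rewrite -leNgt => h1.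
  have := pairing (polyval c D n *+ k) (ex_intro _ _ erefl); lra.
rewrite sumr_const card_ord -[X in _ <= X]mulr_natl => hup.
have : 0 < M%:R * delta by rewrite mulr_gt0.
by rewrite /eps in hlow hup; lra.
Qed.

End Action.
End SemiInnerProduct.

(** * Conjugation families of integer matrices *)

Lemma char_poly_conj (R : comNzRingType) (d : nat) (g h A : 'M[R]_d) :
  g *m h = 1%:M -> char_poly (g *m A *m h) = char_poly A.
Proof.
move=> gh; pose C := map_mx (@polyC R).
have CM (X Y : 'M[R]_d) : C d d (X *m Y) = C d d X *m C d d Y by rewrite /C map_mxM.
have Cgh : C d d g *m C d d h = 1%:M by rewrite -CM gh /C map_mx1.
have -> : char_poly (g *m A *m h) = \det (C d d g *m char_poly_mx A *m C d d h).
  rewrite /char_poly; congr (\det _); rewrite /char_poly_mx -/(C d d _) !CM.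
  rewrite mulmxBr mulmxBl; congr (_ - _).
  by rewrite scalar_mxC -mulmxA Cgh mulmx1.
by rewrite !det_mulmx mulrAC -det_mulmx Cgh det1 mul1r.
Qed.

(** Substituting [k X] in the characteristic polynomial of [k A] gives
    [det (k X - k A) = k ^+ d * det (X - A)]; compare coefficients and cancel [k ^+ i]. *)
Lemma coef_char_poly_scale (d : nat) (k : int) (A : 'M[int]_d) i : k != 0 -> (i <= d)%N ->
  (char_poly (k *: A))`_i = k ^+ (d - i) * (char_poly A)`_i.
Proof.
move=> k0 id.
have e : char_poly (k *: A) \Po (k *: 'X) = k ^+ d *: char_poly A.
  rewrite /char_poly -det_map_mx /= -[k ^+ d *: _]mul_polyC polyC_exp -detZ.
  congr (\det _); apply/matrixP => a b; rewrite !mxE /= rmorphB rmorphMn /=.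
  rewrite comp_polyX comp_polyC polyCM mulrBr -mul_polyC.
  by rewrite mulrnAr.
have := congr1 (fun p : {poly int} => p`_i) e; rewrite coefZ.
have -> : (char_poly (k *: A) \Po (k *: 'X))`_i = k ^+ i * (char_poly (k *: A))`_i.
  rewrite comp_polyE coef_sum.
  under eq_bigr => j _ do rewrite exprZn !coefZ coefXn.
  have [lt|ge] := ltnP i (size (char_poly (k *: A))).
    rewrite (bigD1 (Ordinal lt)) //= eqxx mulr1 big1 ?addr0 1?mulrC // => j ji.
    by rewrite (_ : (i == j) = false) ?mulr0 //; apply/eqP => ij; case/eqP: ji; apply: val_inj.
  rewrite nth_default // mulr0 big1 // => j _.
  by rewrite (_ : (i == j) = false) ?mulr0 //; apply/eqP => ij; have := ltn_ord j; rewrite -ij ltnNge ge.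
move=> h; apply: (mulfI (expf_neq0 i k0)).
by rewrite h mulrA -exprD subnKC.
Qed.

Section Families.
Variable d : nat.
Implicit Types (A X : 'M[int]_d) (s t : seq 'M[int]_d) (i j k l : 'I_d).

Fixpoint mev s (x : int) : 'M[int]_d := if s is X :: s' then X + x *: mev s' x else 0.

Lemma mevE s n : mev s n%:Z = \sum_(j < size s) nth 0 s j *~ (n%:Z ^+ j).
Proof.
elim: s => [|X s IH]; first by rewrite big_ord0.
rewrite big_ord_recl /= expr0 mulr1z IH scaler_sumr; congr (_ + _).
by apply: eq_bigr => i _; rewrite -[in RHS]scaler_int -scaler_int !intz scalerA -exprS.
Qed.

Lemma mev_cat s t x : mev (s ++ t) x = mev s x + x ^+ size s *: mev t x.
Proof.
elim: s => [|X s IH] /=; first by rewrite add0r expr0 scale1r.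
by rewrite IH scalerDr scalerA -exprS addrA.
Qed.

Lemma mev_map (f : {linear 'M[int]_d -> 'M[int]_d}) s x : mev (map f s) x = f (mev s x).
Proof. by elim: s => [|X s IH] /=; rewrite ?linear0 // linearD linearZ /= IH. Qed.

Notation E := delta_mx.

(** [commE] and [sandE] give the coefficients of [y] and [y ^+ 2] in [(1 + y E) X (1 - y E)]. *)
Definition commE i j X : 'M[int]_d := E i j *m X - X *m E i j.
Definition sandE i j X : 'M[int]_d := - (E i j *m X *m E i j).

Lemma commE_is_linear i j : linear (commE i j).
Proof.
move=> a X Y; rewrite /commE linearP /= mulmxDl -scalemxAl scalerBr opprD.
by rewrite addrACA.
Qed.
HB.instance Definition _ i j :=
  GRing.isLinear.Build int _ _ _ (commE i j) (commE_is_linear i j).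

Lemma sandE_is_linear i j : linear (sandE i j).
Proof.
by move=> a X Y; rewrite /sandE linearP /= mulmxDl -scalemxAl opprD scalerN.
Qed.
HB.instance Definition _ i j :=
  GRing.isLinear.Build int _ _ _ (sandE i j) (sandE_is_linear i j).

(* Conjugation by [1 + x^m E_ij], [m = size s]: the three blocks of
   coefficients do not overlap. *)
Definition conj_coefs i j s := s ++ map (commE i j) s ++ map (sandE i j) s.

Lemma delta_sqr0 i j : i != j -> E i j *m E i j = 0 :> 'M[int]_d.
Proof. by move=> ij; rewrite mul_delta_mx_0 // eq_sym. Qed.

Lemma char_poly_conj_coefs i j s x : i != j ->
  char_poly (mev (conj_coefs i j s) x) = char_poly (mev s x).
Proof.
move=> ij; set y := x ^+ size s; set X := mev s x; set e : 'M[int]_d := E i j.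
have e0 : e *m e = 0 by apply: delta_sqr0.
have -> : mev (conj_coefs i j s) x = (1%:M + y *: e) *m X *m (1%:M - y *: e).
  rewrite /conj_coefs !mev_cat !mev_map size_map -/y -/X /= /commE /sandE -/e.
  rewrite mulmxDl mul1mx mulmxBr mulmx1 mulmxDl -!scalemxAl -!scalemxAr.
  by rewrite !scalerDr !scalerN !scalerA !opprD !addrA.
apply: char_poly_conj.
by rewrite mulmxBr mulmx1 mulmxDl mul1mx -!scalemxAl -!scalemxAr e0 !scaler0 addr0 addrK.
Qed.

Inductive conj_family A : seq 'M[int]_d -> Prop :=
| conj_family0 : conj_family A [:: A]
| conj_familyS i j s : i != j -> conj_family A s -> conj_family A (conj_coefs i j s).

Lemma conj_family_neq0 A s : conj_family A s -> s != [::].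
Proof. by elim=> // i j {}s _ _; rewrite /conj_coefs; case: s. Qed.

Lemma char_poly_conj_family A s x : conj_family A s -> char_poly (mev s x) = char_poly A.
Proof.
elim=> [|i j {}s ij _ <-]; first by rewrite /= scaler0 addr0.
exact: char_poly_conj_coefs.
Qed.

(* Membership in the subgroup generated by [s]. *)
Definition gen s X := forall K : 'M[int]_d -> Prop,
  K 0 -> (forall Y Z, K Y -> K Z -> K (Y - Z)) -> (forall Y, Y \in s -> K Y) -> K X.

Lemma gen0 s : gen s 0. Proof. by move=> K. Qed.

Lemma genB s X Y : gen s X -> gen s Y -> gen s (X - Y).
Proof. by move=> hX hY K K0 KB Ks; apply: (KB); [apply: (hX K) | apply: (hY K)]. Qed.

Lemma genN s X : gen s X -> gen s (- X).
Proof. by move=> hX; rewrite -sub0r; apply: genB => //; apply: gen0. Qed.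

Lemma genD s X Y : gen s X -> gen s Y -> gen s (X + Y).
Proof. by move=> hX hY; rewrite -[Y]opprK; apply: genB => //; apply: genN. Qed.

Lemma genZ s (z : int) X : gen s X -> gen s (z *: X).
Proof.
move=> hX; have hn (n : nat) : gen s (n%:Z *: X).
  elim: n => [|n IH]; first by rewrite scale0r; apply: gen0.
  by rewrite intS scalerDl scale1r; apply: genD.
by case: z => n //; rewrite NegzE scaleNr; apply: genN.
Qed.

Lemma gen_sum s (I : Type) (r : seq I) (P : pred I) (F : I -> 'M[int]_d) :
  (forall a, P a -> gen s (F a)) -> gen s (\sum_(a <- r | P a) F a).
Proof. by move=> h; apply: big_ind => //; apply: genD. Qed.

Lemma gen_sub s t X : {subset s <= t} -> gen s X -> gen t X.
Proof. by move=> st hX K K0 KB Kt; apply: (hX K) => // Y /st; apply: Kt. Qed.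

Lemma gen_map (f : {linear 'M[int]_d -> 'M[int]_d}) s t X :
  {subset map f s <= t} -> gen s X -> gen t (f X).
Proof.
move=> st hX K K0 KB Kt; apply: (hX (fun Y => K (f Y))).
- by rewrite linear0.
- by move=> Y Z hY hZ; rewrite linearB; apply: KB.
- by move=> Y Ys; apply: Kt; apply: st; apply: map_f.
Qed.

(** [behead] drops the constant coefficient, which does not enter the lattice. *)
Definition ext A s t := conj_family A t /\ forall X, gen (behead s) X -> gen (behead t) X.

Lemma ext_trans A s t u : ext A s t -> ext A t u -> ext A s u.
Proof. by move=> [_ st] [hu tu]; split=> // X /st /tu. Qed.

(** The old list is a prefix of the new one, so the images of all its members, the constant term
    included, become non-constant coefficients. *)
Lemma conj_extension A s i j : i != j -> conj_family A s ->
  [/\ ext A s (conj_coefs i j s),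
      forall X, gen s X -> gen (behead (conj_coefs i j s)) (commE i j X) &
      forall X, gen s X -> gen (behead (conj_coefs i j s)) (sandE i j X)].
Proof.
move=> ij fs; have := conj_family_neq0 fs; have := conj_familyS ij fs.
case: s fs => // a s fs ft _.
have e : behead (conj_coefs i j (a :: s)) =
  s ++ map (commE i j) (a :: s) ++ map (sandE i j) (a :: s) by [].
split; [split=> // X|move=> X|move=> X]; rewrite e.
- by apply: gen_sub => Y Ys; rewrite mem_cat Ys.
- by apply: gen_map => Y Ys; rewrite !mem_cat Ys orbT.
- by apply: gen_map => Y Ys; rewrite !mem_cat Ys !orbT.
Qed.

Lemma gen_behead s X : gen (behead s) X -> gen s X.
Proof. by apply: gen_sub; case: s => // a s Y Ys; rewrite inE Ys orbT. Qed.

Lemma mulEE i j k l : E i j *m E k l = (j == k)%:R *: E i l :> 'M[int]_d.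
Proof. by rewrite mul_delta_mx_cond scaler_nat. Qed.

(** [commE k i (E i j) = E k j]. *)
Lemma reach_row A s i j k : conj_family A s -> i != j -> k != j ->
  gen (behead s) (E i j) -> exists2 t, ext A s t & gen (behead t) (E k j).
Proof.
move=> fs ij kj h; have [<-|ik] := eqVneq i k; first by exists s.
rewrite eq_sym in ik.
have [st hc _] := conj_extension ik fs.
exists (conj_coefs k i s) => //; have := hc _ (gen_behead h).
by rewrite /commE !mulEE eqxx eq_sym (negbTE kj) scale0r subr0 scale1r.
Qed.

(** [commE j l (E i j) = - E i l]. *)
Lemma reach_col A s i j l : conj_family A s -> i != j -> i != l ->
  gen (behead s) (E i j) -> exists2 t, ext A s t & gen (behead t) (E i l).
Proof.
move=> fs ij il h; have [<-|jl] := eqVneq j l; first by exists s.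
have [st hc _] := conj_extension jl fs.
exists (conj_coefs j l s) => //; have := genN (hc _ (gen_behead h)).
by rewrite /commE !mulEE eqxx [l == i]eq_sym (negbTE il) scale0r sub0r opprK scale1r.
Qed.

(** [sandE j i (E i j) = - E j i], and [commE j i (E i j)] is the diagonal difference. *)
Lemma reach_swap A s i j : conj_family A s -> i != j -> gen (behead s) (E i j) ->
  exists t, [/\ ext A s t, gen (behead t) (E j i) & gen (behead t) (E j j - E i i)].
Proof.
move=> fs ij h; have ji : j != i by rewrite eq_sym.
have [st hc hs] := conj_extension ji fs.
exists (conj_coefs j i s); split=> //.
  have := genN (hs _ (gen_behead h)).
  by rewrite /sandE opprK mulEE eqxx scale1r mulEE eqxx scale1r.
by have := hc _ (gen_behead h); rewrite /commE !mulEE !eqxx !scale1r.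
Qed.

(** The row is changed first, then the column. The new row must not be [j], so for [k = j] the two
    indices are swapped instead. *)
Lemma reach_delta A s i j k l : conj_family A s -> i != j -> k != l ->
  gen (behead s) (E i j) -> exists2 t, ext A s t & gen (behead t) (E k l).
Proof.
move=> fs ij kl h; have [kj|kj] := eqVneq k j; last first.
  have [t st ht] := reach_row fs ij kj h.
  have [u tu hu] := reach_col st.1 kj kl ht.
  by exists u => //; apply: ext_trans tu.
rewrite {}kj in kl *; have [t [st ht _]] := reach_swap fs ij h.
have ji : j != i by rewrite eq_sym.
have [u tu hu] := reach_col st.1 ji kl ht.
by exists u => //; apply: ext_trans tu.
Qed.

Lemma reach_all A s i j (ts : seq 'M[int]_d) : conj_family A s -> gen (behead s) (E i j) ->
  (forall X, X \in ts -> forall s, conj_family A s -> gen (behead s) (E i j) ->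
     exists2 t, ext A s t & gen (behead t) X) ->
  exists2 t, ext A s t & forall X, X \in ts -> gen (behead t) X.
Proof.
move=> fs h; elim: ts => [|X ts IH] hts; first by exists s.
have [|t st ht] := IH; first by move=> Y Yts; apply: hts; rewrite inE Yts orbT.
have [|u tu hu] := hts X _ t st.1 (st.2 _ h); first by rewrite inE eqxx.
exists u; first exact: ext_trans tu.
by move=> Y; rewrite inE => /predU1P[->//|/ht /tu.2].
Qed.

(** The unit entry starts the process: [E i j *m A *m E i j = A j i *: E i j]. From this one matrix
    unit all off-diagonal units and all diagonal differences are reached. *)
Lemma spanning_family A i j : i != j -> A j i = 1 ->
  exists2 s, conj_family A s & forall X, \tr X = 0 -> gen (behead s) X.
Proof.
move=> ij Aji.
have [[fs _] _ hs] := conj_extension ij (conj_family0 A).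
have hE : gen (behead (conj_coefs i j [:: A])) (E i j).
  have /genN := hs A (fun K _ _ h => h A (mem_head _ _)).
  congr (gen _ _); rewrite /sandE opprK; apply/matrixP => a b; rewrite !mxE.
  rewrite (bigD1 i) //= !mxE (bigD1 j) //= !mxE !eqxx Aji andbT mulr1.
  rewrite big1 ?addr0 => [|c cj]; last by rewrite !mxE (negbTE cj) andbF mul0r.
  rewrite big1 ?addr0 => [|c ci]; last by rewrite !mxE (negbTE ci) mulr0.
  by rewrite /= -natrM mulnb.
pose ts := [seq E p.1 p.2 | p <- enum [pred p : 'I_d * 'I_d | p.1 != p.2]] ++
           [seq E p.1 p.1 - E p.2 p.2 | p <- enum [pred p : 'I_d * 'I_d | p.1 != p.2]] : seq 'M[int]_d.
have [|s [fs' _] hts] := @reach_all A _ i j ts fs hE.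
  move=> X; rewrite mem_cat => /orP[] /mapP[[k l]]; rewrite mem_enum inE /= => kl -> s' fs' hs'.
    exact: reach_delta hs'.
  have lk : l != k by rewrite eq_sym.
  have [t st ht] := reach_delta fs' ij lk hs'.
  have [u [tu _ hu]] := reach_swap st.1 lk ht.
  by exists u => //; apply: ext_trans tu.
exists s => // X trX.
have offd k l : k != l -> gen (behead s) (E k l).
  by move=> kl; apply: hts; rewrite mem_cat; apply/orP; left; apply/mapP; exists (k, l); rewrite ?mem_enum.
have diag k : gen (behead s) (E k k - E i i).
  have [->|ki] := eqVneq k i; first by rewrite subrr; apply: gen0.
  by apply: hts; rewrite mem_cat; apply/orP; right; apply/mapP; exists (k, i); rewrite ?mem_enum.
(* Subtracting [E i i] in every diagonal term changes the sum by [\tr X *: E i i], which is zero. *)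
have -> : X = \sum_k (X k k *: (E k k - E i i) + \sum_(l | l != k) X k l *: E k l).
  rewrite big_split /=; under [in RHS]eq_bigr do rewrite scalerBr.
  rewrite sumrB -scaler_suml [\sum_k X k k]trX scale0r subr0 -big_split /=.
  rewrite {1}[X]matrix_sum_delta; apply: eq_bigr => k _.
  by rewrite (bigD1 k).
apply: gen_sum => k _; apply: genD; first exact: genZ.
by apply: gen_sum => l lk; apply: genZ; apply: offd; rewrite eq_sym.
Qed.

End Families.

(** * Invariant means *)

Definition bdd (X : Type) (R : realType) (f : X -> R) := exists B : R, forall x, `|f x| <= B.

Lemma bddD X (R : realType) (f g : X -> R) : bdd f -> bdd g -> bdd (fun x => f x + g x).
Proof.
move=> [B hB] [C hC]; exists (B + C) => x.
by apply: le_trans (ler_normD _ _) _; apply: lerD.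
Qed.

Lemma bddM X (R : realType) (f g : X -> R) : bdd f -> bdd g -> bdd (fun x => f x * g x).
Proof.
by move=> [B hB] [C hC]; exists (B * C) => x; rewrite normrM; apply: ler_pM.
Qed.

Lemma bdd_cst X (R : realType) (a : R) : bdd (fun _ : X => a).
Proof. by exists `|a|. Qed.

(** * Limits along an ultrafilter *)

Section GeneralizedLimit.
Local Open Scope classical_set_scope.
Import numFieldNormedType.Exports.

(** Compactness gives a cluster point, and an ultrafilter converges to its cluster points. *)
Lemma ultra_bounded_cvg (R : realType) (U : set_system nat) (u : nat -> R) :
  UltraFilter U -> bdd u -> cvg (u @ U).
Proof.
move=> UU [B hB].
have PU : ProperFilter (u @ U) by apply: fmap_proper_filter.
have FA : (u @ U) `[- B, B].
  apply: (@filterE _ U) => n /=; rewrite in_itv /= -ler_norml; exact: hB.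
have [p [_ clp]] := @segment_compact R (- B) B _ PU FA.
apply/cvg_ex; exists p => W Wp; rewrite /fmap /=.
have [//|UnW] := in_ultra_setVsetC (u @^-1` W) UU.
have [x []] : (~` W) `&` W !=set0 by apply: clp.
by [].
Qed.

(** The ultrafilter refines the neighbourhoods of infinity within [P]. Positivity is then tested on
    [P] only, which lets the mean see a subsequence of large density. *)
Lemma generalized_limit (R : realType) (P : set nat) :
  (forall n, exists2 m, (n <= m)%N & P m) ->
  exists L : (nat -> R) -> R,
  [/\ forall u v, bdd u -> bdd v -> L (fun n => u n + v n) = L u + L v,
      forall a u, bdd u -> L (fun n => a * u n) = a * L u,
      L (fun=> 1) = 1 &
      forall u, bdd u -> (exists N, forall n, (N <= n)%N -> P n -> 0 <= u n) -> 0 <= L u].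
Proof.
move=> Pinf; have PF : ProperFilter (within P \oo).
  split; last exact: within_filter.
  move=> [N _ hN]; have [m Nm Pm] := Pinf N.
  exact: hN Nm Pm.
have [U [UU FU]] := ultraFilterLemma PF.
have cv (u : nat -> R) := @ultra_bounded_cvg R U u UU.
exists (fun u => lim (u @ U)); split.
- by move=> u v /cv cu /cv cv'; apply: limD.
- by move=> a u /cv cu; apply: cvg_lim => //; apply: cvgM => //; apply: cvg_cst.
- exact: lim_cst.
- move=> u /cv cu [N hN]; apply: limr_ge => //.
  by apply: FU; exists N => // n /=; apply: hN.
Qed.

End GeneralizedLimit.

Section BoundedFunctions.
Variables (X : Type) (R : realType).

Definition bddf : {pred X -> R^o} := [pred f | `[< bdd (f : X -> R) >]].

Lemma bddf_submod : submod_closed bddf.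
Proof.
split; first by apply/asboolP; apply: (bdd_cst X (0 : R)).
move=> a f g /asboolP hf /asboolP hg; apply/asboolP.
apply: (bddD (f := fun x => a * f x) (g := g)) => //.
by apply: (bddM (f := fun=> a)) => //; apply: bdd_cst.
Qed.

Record bfun := Bfun { bval : X -> R^o; _ : bval \in bddf }.
HB.instance Definition _ := [isSub for bval].
HB.instance Definition _ := [Choice of bfun by <:].
HB.instance Definition _ := GRing.isSubmodClosed.Build _ _ bddf bddf_submod.
HB.instance Definition _ := [SubChoice_isSubLmodule of bfun by <:].

Lemma bfun_bdd (f : bfun) : bdd (bval f : X -> R).
Proof. by case: f => f /= /asboolP. Qed.

Definition mkbfun (f : X -> R) (hf : bdd f) : bfun := @Bfun f (asboolT hf).

Lemma bfun_ext (f g : bfun) : bval f =1 bval g -> f = g.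
Proof. by move=> h; apply: val_inj; apply: funext. Qed.

End BoundedFunctions.

Section InvariantMean.
Variables (R : realType) (G : zmodType) (pi : {additive G -> G}).
Variable mu : (G -> R) -> R.
Hypothesis muD : forall f g, bdd f -> bdd g -> mu (fun x => f x + g x) = mu f + mu g.
Hypothesis muZ : forall a f, bdd f -> mu (fun x => a * f x) = a * mu f.
Hypothesis mu1 : mu (fun=> 1) = 1.
Hypothesis mu_ge0 : forall f, bdd f -> (forall x, 0 <= f x) -> 0 <= mu f.
Hypothesis mu_inv : forall v f, bdd f -> mu (fun x => f (x + pi v)) = mu f.

Let V := bfun G R.
Let ip (f g : V) := mu (fun x => (bval f x : R) * bval g x).

Let T_bdd (v : G) (f : V) : bdd (fun x => bval f (x + pi v) : R).
Proof. by case: (bfun_bdd f) => B hB; exists B => x; apply: hB. Qed.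

Let T (v : G) (f : V) : V := mkbfun (T_bdd v f).

(** The recurrence theorem is applied to the indicator [e] of [E], with the mean of a product as
    inner product. A positive inner product of [e] with a translate yields a point, as otherwise the
    product vanishes identically. *)
Lemma mean_recurrence (E : G -> Prop) (delta : R) : 0 < delta ->
  delta <= mu (fun x => (`[< E x >])%:R) ->
  exists2 k, (0 < k)%N & forall D (c : nat -> G),
    (forall g, exists2 y, lat D c y & pi g = pi y) ->
    exists n x, E x /\ E (x + pi (polyval c D n *+ k)).
Proof.
move=> d0 hE.
have ipC f g : ip f g = ip g f.
  by congr (mu _); apply: funext => x; rewrite mulrC.
have ipDl f g h : ip (f + g) h = ip f h + ip g h.
  rewrite /ip -muD; try by apply: bddM; apply: bfun_bdd.
  by congr (mu _); apply: funext => x; rewrite -mulrDl.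
have ipZl a f h : ip (a *: f) h = a * ip f h.
  rewrite /ip -muZ; last by apply: bddM; apply: bfun_bdd.
  by congr (mu _); apply: funext => x; rewrite mulrA.
have ip_ge0 f : 0 <= ip f f.
  apply: mu_ge0; first by apply: bddM; apply: bfun_bdd.
  by move=> x; rewrite -expr2 sqr_ge0.
have TD v f g : T v (f + g) = T v f + T v g by apply: bfun_ext.
have TZ v a f : T v (a *: f) = a *: T v f by apply: bfun_ext.
have T0 f : T 0 f = f by apply: bfun_ext => x /=; rewrite raddf0 addr0.
have TM v w f : T (v + w) f = T v (T w f).
  by apply: bfun_ext => x /=; rewrite raddfD addrA.
have ipT v f g : ip (T v f) (T v g) = ip f g.
  by apply: (mu_inv v (f := fun x => bval f x * bval g x)); apply: bddM; apply: bfun_bdd.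
have E_bdd : bdd (fun x => (`[< E x >])%:R : R).
  by exists 1 => x; case: asboolP => _; rewrite ?normr1 ?normr0.
pose e : V := mkbfun E_bdd; pose one : V := mkbfun (bdd_cst G 1).
have one1 : ip one one = 1.
  by rewrite -[RHS]mu1; congr (mu _); apply: funext => x; rewrite /= mulr1.
have nrm1 : nrm ip one = 1 by rewrite /nrm one1 sqrtr1.
have eone : delta <= ip e one.
  by apply: le_trans hE _; rewrite le_eqVlt; apply/orP; left; apply/eqP; congr (mu _);
     apply: funext => x; rewrite /= mulr1.
have e1 : nrm ip e <= 1.
  rewrite nrm_le // expr1n -one1 -subr_ge0.
  have -> : ip one one - ip e e = mu (fun x => 1 + (-1) * (bval e x * bval e x)).
    rewrite muD; [|exact: bdd_cst|by apply: bddM; [apply: bdd_cst | apply: bddM; apply: bfun_bdd]].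
    rewrite muZ; last by apply: bddM; apply: bfun_bdd.
    by rewrite mulN1r one1 mu1.
  apply: mu_ge0; first apply: bddD; first exact: bdd_cst.
    by apply: bddM; [apply: bdd_cst | apply: bddM; apply: bfun_bdd].
  by move=> x /=; case: asboolP => _; rewrite /=; lra.
(* Averages keep the inner product with [one], so Cauchy-Schwarz bounds their squared norms below by
   [delta ^+ 2]. *)
have Aone A : Avg T (fun=> True) A -> ip (A e) one = ip e one.
  elim=> [v _|B C _ hB _ hC].
    by rewrite -{1}(_ : T v one = one) ?ipT //; apply: bfun_ext.
  by rewrite ipZl ipDl hB hC; field.
have d20 : 0 < delta ^+ 2 by rewrite exprn_gt0.
have [|k k0 hk] := @uniform_polynomial_recurrence R V ip ipC ipDl ipZl ip_ge0 G T
  TD TZ T0 TM ipT e _ e1 d20.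
  move=> A hA; have := ip_sqr ipC ipDl ipZl ip_ge0 (A e) one.
  rewrite one1 mulr1 (Aone _ hA); apply: le_trans.
  by rewrite ler_sqr ?nnegrE ?(ltW d0) // (le_trans (ltW d0)).
exists k => // D c full; have [|n hn] := hk D c.
  move=> g; have [y hy e'] := full g; exists y => //.
  by apply: funext => f; apply: bfun_ext => x /=; rewrite e'.
exists n; apply: contrapT => /forallNP none; move: hn.
have -> : ip e (T (polyval c D n *+ k) e) = mu (fun=> 0 * 1).
  congr (mu _); apply: funext => x /=; rewrite mul0r.
  by case: asboolP => Ex; case: asboolP => Ex'; rewrite ?mulr0 ?mul0r //; case: (none x).
by rewrite muZ ?mul0r ?ltxx //; apply: bdd_cst.
Qed.

End InvariantMean.

(** * Averages over boxes *)

Lemma companion_matrix (d : nat) (p : {poly int}) : (2 <= d)%N -> p \is monic ->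
  size p = d.+1 -> exists (C : 'M[int]_d) (i j : 'I_d),
  [/\ char_poly C = p, i != j & C j i = 1].
Proof.
move=> d2 pm sp; have e : (size p).-1 = d by rewrite sp.
(* [companionmx p] has dimension [(size p).-1], which first replaces [d]. The unit entry is in row 0
   and column 1; row 0 is not the last row, as the dimension is at least 2. *)
case: _ / e d2 {sp} => d2; exists (companionmx p).
exists (Ordinal d2), (Ordinal (ltnW d2)); split=> //; first exact: companionmxK.
by rewrite !mxE /= ifN //; case: (size p) d2 => [|[|[|m]]].
Qed.

Lemma coef_scaled_poly (d : nat) (z : int) (a : nat -> int) i :
  (scaled_poly d z a)`_i = (i == d)%:R + \sum_(j < d.-1) (z ^+ (d - j) * a j) * (i == j)%:R.
Proof.
rewrite /scaled_poly coefD coefXn coef_sum; congr (_ + _).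
by apply: eq_bigr => j _; rewrite coefCM coefXn.
Qed.

Lemma coef_scaled_poly_pred (d : nat) (z : int) (a : nat -> int) : (0 < d)%N ->
  (scaled_poly d z a)`_d.-1 = 0.
Proof.
move=> d0; rewrite coef_scaled_poly ltn_eqF ?prednK // add0r big1 // => j _.
by rewrite gtn_eqF ?mulr0.
Qed.

Lemma size_scaled_poly_tail (d : nat) (z : int) (a : nat -> int) :
  (size (\sum_(i < d.-1) (z ^+ (d - i) * a i)%:P * 'X^i)%R <= d)%N.
Proof.
apply: leq_trans (size_sum _ _ _) _; apply/bigmax_leqP => i _.
rewrite mul_polyC; apply: leq_trans (size_scale_leq _ _) _; rewrite size_polyXn.
by apply: leq_trans (ltn_ord i) (leq_pred d).
Qed.

Lemma size_scaled_poly (d : nat) (z : int) (a : nat -> int) :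
  size (scaled_poly d z a) = d.+1.
Proof.
by rewrite /scaled_poly size_polyDl size_polyXn // ltnS size_scaled_poly_tail.
Qed.

Lemma scaled_poly_monic (d : nat) (z : int) (a : nat -> int) : scaled_poly d z a \is monic.
Proof.
by rewrite monicE /scaled_poly lead_coefDl ?lead_coefXn // size_polyXn ltnS size_scaled_poly_tail.
Qed.

Lemma char_poly_scaled (d : nat) (k : nat) (a : nat -> int) (A : 'M[int]_d) :
  (0 < k)%N -> char_poly A = scaled_poly d 1 a ->
  char_poly (k%:Z *: A) = scaled_poly d k%:Z a.
Proof.
move=> k0 hA.
apply/polyP => i; have [di|id] := ltnP d i.
  rewrite nth_default ?size_char_poly // coef_scaled_poly gtn_eqF // add0r big1 // => j _.
  by rewrite gtn_eqF ?mulr0 //; have := ltn_ord j; lia.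
rewrite coef_char_poly_scale ?hA //; last by rewrite eqz_nat -lt0n.
rewrite !coef_scaled_poly mulrDr; congr (_ + _).
  by case: eqP => [->|_]; rewrite ?mulr0 // subnn expr0 mulr1.
rewrite mulr_sumr; apply: eq_bigr => j _.
by case: eqP => [->|_]; rewrite ?mulr0 // expr1n !mulr1 mul1r.
Qed.

(** * The box mean and its translation invariance *)

Section BoxAverages.
Variables (R : realType) (d : nat).
Hypothesis d2 : (2 <= d)%N.

Let dlast : (d.-1 < d)%N. Proof. by rewrite prednK // ltnW. Qed.
Let l : 'I_d := Ordinal dlast.

Let lastE (i : 'I_d) : is_last i = (i == l).
Proof. by rewrite /is_last -val_eqE. Qed.

(* Projection onto trace-zero matrices; it makes all of ['M[int]_d] act. *)
Definition trproj (v : 'M[int]_d) : 'M[int]_d := v - \tr v *: delta_mx l l.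

Lemma trproj_is_additive : {morph trproj : u v / u - v}.
Proof.
move=> u v; rewrite /trproj raddfB /= scalerBl !opprB addrACA [RHS]addrACA.
by congr (_ + _); rewrite addrC.
Qed.
HB.instance Definition _ :=
  GRing.isZmodMorphism.Build 'M[int]_d 'M[int]_d trproj trproj_is_additive.

Lemma mxtrace_delta : \tr (delta_mx l l : 'M[int]_d) = 1.
Proof.
rewrite /mxtrace (bigD1 l) //= mxE !eqxx big1 ?addr0 // => i il.
by rewrite mxE (negbTE il).
Qed.

Lemma mxtrace_trproj v : \tr (trproj v) = 0.
Proof. by rewrite /trproj raddfB /= mxtraceZ mxtrace_delta mulr1 subrr. Qed.

Lemma trproj_id v : \tr v = 0 -> trproj v = v.
Proof. by move=> v0; rewrite /trproj v0 scale0r subr0. Qed.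

Let F n := F_list d n.

Let memF n A : (A \in F n) <-> inF n A.
Proof. by apply: mem_F_list; apply: ltnW. Qed.

Let szF n : 0 < (size (F n))%:R :> R.
Proof.
rewrite ltr0n lt0n size_eq0; apply/eqP => e.
have : 0 \in F n by apply/memF; split=> [|i j _]; rewrite ?/tracezero ?mxtrace0 ?mxE ?normr0.
by rewrite e.
Qed.

Definition box_avg (f : 'M[int]_d -> R) n := (\sum_(x <- F n) f x) / (size (F n))%:R.

Lemma box_avg_le (f g : 'M[int]_d -> R) n : (forall x, f x <= g x) ->
  box_avg f n <= box_avg g n.
Proof. by move=> fg; rewrite ler_pM2r ?invr_gt0 //; apply: ler_sum. Qed.

Lemma box_avg_cst a n : box_avg (fun=> a) n = a.
Proof.
by rewrite /box_avg big_const_seq count_predT iter_addr addr0 -[a *+ _]mulr_natr mulfK ?lt0r_neq0.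
Qed.

Lemma box_avg_bdd f : bdd f -> bdd (box_avg f).
Proof.
move=> [B hB]; exists B => n; rewrite ler_norml -{1}(box_avg_cst (- B) n).
rewrite -{2}(box_avg_cst B n); apply/andP; split; apply: box_avg_le => x;
by have := hB x; rewrite ler_norml => /andP[].
Qed.

Lemma box_avgD f g n : box_avg (fun x => f x + g x) n = box_avg f n + box_avg g n.
Proof. by rewrite /box_avg big_split mulrDl. Qed.

Lemma box_avgZ a f n : box_avg (fun x => a * f x) n = a * box_avg f n.
Proof. by rewrite /box_avg -mulr_sumr mulrA. Qed.

Let unit_shift (i j : 'I_d) := trproj (delta_mx i j).

Lemma unit_shiftE i j a b : ~~ (is_last a && is_last b) ->
  unit_shift i j a b = ((a == i) && (b == j))%:R.
Proof. by rewrite !lastE => /negbTE ab; rewrite /unit_shift /trproj !mxE ab mulr0 subr0. Qed.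

(* Each point leaving the box under the shift ends a full line of the box. *)
Lemma box_boundary i j n : ~~ (is_last i && is_last j) ->
  (count (fun x => (x + unit_shift i j)%R \notin F n) (F n) * (2 * n).+1 <= size (F n))%N.
Proof.
move=> ij; set v := unit_shift i j.
set S := [seq x <- F n | x + v \notin F n].
have vij : v i j = 1 by rewrite unit_shiftE // !eqxx.
(* Outside the corner [(d, d)] the shift changes only the entry [(i, j)], so a point leaves the box
   only if this entry is [n]. *)
have Sn x : x \in S -> x \in F n /\ x i j = n%:Z.
  rewrite mem_filter => /andP[xv xF]; split=> //; move/memF: (xF) => [trx bx].
  apply/eqP; apply: contraNT xv => xij; apply/memF; split.
    by rewrite /tracezero raddfD /= trx add0r mxtrace_trproj.
  move=> a b ab; rewrite mxE unit_shiftE //; have := bx a b ab.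
  case: eqP => [->|_] /=; last by rewrite addr0.
  case: eqP => [->|_] /=; last by rewrite addr0.
  by move: xij; move: (x i j) => z; lia.
(* On the line [x - v *+ t] the entry [(i, j)] runs from [n] down to [- n] and determines [t], so
   lines through different points of [S] do not meet. *)
have sz : size [seq x - v *+ t | x <- S, t <- iota 0 (2 * n).+1] = (size S * (2 * n).+1)%N.
  by rewrite size_allpairs size_iota.
rewrite -size_filter -/S -sz; apply: uniq_leq_size.
  apply: allpairs_uniq; rewrite ?iota_uniq ?filter_uniq ?undup_uniq //.
  move=> p q /allpairsPdep[x [t [xS _ ->]]] /allpairsPdep[y [u [yS _ ->]]] /= e.
  have tu : t = u.
    have := congr1 (fun M : 'M[int]_d => M i j) e; rewrite !mxE !mulmxnE vij.
    by rewrite (Sn _ xS).2 (Sn _ yS).2 => /addrI /oppr_inj; rewrite !natz => -[].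
  by move: e; rewrite tu => /addIr ->.
move=> y /allpairsPdep[x [t [xS + ->]]]; rewrite mem_iota add0n => /= tn.
have [xF xij] := Sn _ xS; move/memF: xF => [trx bx]; apply/memF; split.
  by rewrite /tracezero raddfB raddfMn /= trx mxtrace_trproj mul0rn subr0.
move=> a b ab; rewrite !mxE mulmxnE unit_shiftE //; have := bx a b ab.
case: eqP => [->|_] /=; last by rewrite mul0rn subr0.
case: eqP => [->|_] /=; last by rewrite mul0rn subr0.
by rewrite xij natz; lia.
Qed.

(** Points that stay in the box are sent injectively into it; the others are at most one in
    [(2 * n).+1] and cost at most [B] each. *)
Lemma box_avg_shift i j f B n : ~~ (is_last i && is_last j) -> (forall x, 0 <= f x <= B) ->
  box_avg (fun x => f (x + unit_shift i j)) n <= box_avg f n + B / (2 * n).+1%:R.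
Proof.
move=> ij fB; set v := unit_shift i j.
have n0 : 0 < (2 * n).+1%:R :> R by rewrite ltr0n.
have B0 : 0 <= B by have /andP[h1 h2] := fB 0; apply: le_trans h2.
rewrite /box_avg ler_pdivrMr // mulrDl divfK ?lt0r_neq0 //.
rewrite (bigID (fun x => x + v \in F n)) /=; apply: lerD.
  rewrite -(big_filter _ (fun x => x + v \in F n)) -(big_map (fun x => x + v) xpredT f).
  set s := map _ _.
  have us : uniq s by rewrite map_inj_uniq ?filter_uniq ?undup_uniq //; apply: addIr.
  have pe : perm_eq s [seq x <- F n | x \in s].
    apply: uniq_perm => //; first by rewrite filter_uniq ?undup_uniq.
    move=> x; rewrite mem_filter; apply/idP/andP => [xs|[]//]; split=> //.
    by move: xs => /mapP[y]; rewrite mem_filter => /andP[yv _] ->.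
  rewrite (perm_big _ pe) big_filter /= [leRHS](bigID (mem s)) /= lerDl.
  by apply: sumr_ge0 => x _; have /andP[] := fB x.
apply: (@le_trans _ _ (\sum_(x <- F n | x + v \notin F n) B)).
  by apply: ler_sum => x _; have /andP[] := fB (x + v).
rewrite big_const_seq iter_addr addr0 -[B *+ _]mulr_natr mulrAC -mulrA ler_wpM2l //.
by rewrite ler_pdivlMr // -natrM ler_nat box_boundary.
Qed.

Variable L : (nat -> R) -> R.
Variable P : nat -> Prop.
Hypothesis LD : forall u v, bdd u -> bdd v -> L (fun n => u n + v n) = L u + L v.
Hypothesis LZ : forall a u, bdd u -> L (fun n => a * u n) = a * L u.
Hypothesis L1 : L (fun=> 1) = 1.
Hypothesis L_ge0 : forall u, bdd u ->
  (exists N, forall n, (N <= n)%N -> P n -> 0 <= u n) -> 0 <= L u.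

Lemma L_cst a : L (fun=> a) = a.
Proof.
rewrite (_ : (fun=> a) = (fun n : nat => a * 1)); last by apply: funext => n; rewrite mulr1.
by rewrite LZ ?L1 ?mulr1 //; apply: bdd_cst.
Qed.

Lemma L_le u v : bdd u -> bdd v ->
  (exists N, forall n, (N <= n)%N -> P n -> u n <= v n) -> L u <= L v.
Proof.
move=> bu bv [N hN]; rewrite -subr_ge0.
have bN : bdd (fun n => -1 * u n) by apply: bddM => //; apply: bdd_cst.
have -> : L v - L u = L (fun n => v n + -1 * u n) by rewrite LD // LZ // mulN1r.
apply: L_ge0; first exact: bddD.
by exists N => n Nn Pn; rewrite mulN1r subr_ge0 hN.
Qed.

Definition box_mean f := L (box_avg f).

Lemma bdd_shift (f : 'M[int]_d -> R) v : bdd f -> bdd (fun x => f (x + v)).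
Proof. by move=> [B hB]; exists B => x; apply: hB. Qed.

Lemma box_meanD f g : bdd f -> bdd g ->
  box_mean (fun x => f x + g x) = box_mean f + box_mean g.
Proof.
move=> hf hg; rewrite /box_mean -LD; [|exact: box_avg_bdd|exact: box_avg_bdd].
by congr (L _); apply: funext => n; rewrite box_avgD.
Qed.

Lemma box_meanZ a f : bdd f -> box_mean (fun x => a * f x) = a * box_mean f.
Proof.
move=> hf; rewrite /box_mean -LZ; last exact: box_avg_bdd.
by congr (L _); apply: funext => n; rewrite box_avgZ.
Qed.

Lemma box_mean_cst a : box_mean (fun=> a) = a.
Proof.
by rewrite -[RHS]L_cst; congr (L _); apply: funext => n; rewrite box_avg_cst.
Qed.

Lemma box_mean_ge0 f : bdd f -> (forall x, 0 <= f x) -> 0 <= box_mean f.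
Proof.
move=> hf f0; apply: L_ge0; first exact: box_avg_bdd.
by exists 0%N => n _ _; rewrite -(box_avg_cst 0 n); apply: box_avg_le.
Qed.

Lemma box_mean_shift_le i j f B : ~~ (is_last i && is_last j) -> (forall x, 0 <= f x <= B) ->
  box_mean (fun x => f (x + unit_shift i j)) <= box_mean f.
Proof.
move=> ij fB; have B0 : 0 <= B by have /andP[h1 h2] := fB 0; apply: le_trans h2.
have bf : bdd f by exists B => x; have /andP[h1 h2] := fB x; rewrite ger0_norm.
apply/ler_addgt0Pr => eps eps0; rewrite -[eps]L_cst -LD; [|exact: box_avg_bdd|exact: bdd_cst].
apply: L_le; first by apply: box_avg_bdd; apply: bdd_shift.
  by apply: bddD; [apply: box_avg_bdd | apply: bdd_cst].
have [N hN] := nat_upper_bound (B / eps).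
exists N => n /hN; rewrite ler_pdivrMr // => nB _.
apply: le_trans (box_avg_shift n ij fB) _; rewrite lerD2l.
rewrite ler_pdivrMr ?ltr0n // mulrC; apply: le_trans nB _.
by rewrite ler_wpM2r ?(ltW eps0) // ler_nat; lia.
Qed.

(** Adding a constant extends the one-sided inequality to all bounded functions; applied to [- f] it
    gives the converse. The unit at the corner projects to zero. *)
Lemma box_mean_unit_shift i j f : bdd f ->
  box_mean (fun x => f (x + unit_shift i j)) = box_mean f.
Proof.
move=> bf; have [ij|ij] := boolP (is_last i && is_last j).
  have -> : unit_shift i j = 0.
    move: ij; rewrite !lastE => /andP[/eqP -> /eqP ->].
    by rewrite /unit_shift /trproj mxtrace_delta scale1r subrr.
  by congr box_mean; apply: funext => x; rewrite addr0.
have le g : bdd g -> box_mean (fun x => g (x + unit_shift i j)) <= box_mean g.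
  move=> bg; have [B hB] := bg.
  have := @box_mean_shift_le i j (fun x => g x + B) (B + B) ij.
  rewrite !box_meanD ?box_mean_cst ?lerD2r //; try by [apply: bdd_cst | apply: bdd_shift].
  apply=> x; have := hB x; rewrite ler_norml; lra.
apply/eqP; rewrite eq_le le //=.
have bN : bdd (fun x => -1 * f x) by apply: bddM => //; apply: bdd_cst.
have := le _ bN; rewrite !box_meanZ //; last exact: bdd_shift.
by rewrite !mulN1r lerN2.
Qed.

(** The [v] with this property form a subgroup containing every matrix unit. *)
Lemma box_mean_inv v f : bdd f -> box_mean (fun x => f (x + trproj v)) = box_mean f.
Proof.
pose K v := forall f, bdd f -> box_mean (fun x => f (x + trproj v)) = box_mean f.
have K0 : K 0.
  by move=> g _; congr box_mean; apply: funext => x; rewrite raddf0 addr0.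
have KD u w : K u -> K w -> K (u + w).
  move=> hu hw g bg; rewrite -(hw g bg) -[RHS](hu _ (bdd_shift (trproj w) bg)).
  by congr box_mean; apply: funext => x; rewrite raddfD addrA.
have KN u : K u -> K (- u).
  move=> hu g bg; rewrite -(hu _ (bdd_shift (trproj (- u)) bg)).
  by congr box_mean; apply: funext => x; rewrite -addrA -raddfD subrr raddf0 addr0.
have KZ (z : int) u : K u -> K (z *: u).
  move=> hu; have hn (n : nat) : K (n%:Z *: u).
    elim: n => [|n IH]; first by rewrite scale0r.
    by rewrite intS scalerDl scale1r; apply: KD.
  by case: z => n //; rewrite NegzE scaleNr; apply: KN.
suff : K v by apply.
rewrite (matrix_sum_delta v).
apply: (big_ind K) => // i _; apply: (big_ind K) => // j _.
by apply: KZ => g; apply: box_mean_unit_shift.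
Qed.

End BoxAverages.

(** * From positive upper density to the theorem *)

Lemma limn_sup_frequently (R : realType) (u : nat -> R) :
  (forall n, 0 <= u n <= 1) -> 0 < limn_sup u ->
  forall n, exists2 m, (n <= m)%N & limn_sup u / 2 <= u m.
Proof.
(* Otherwise [sups u n], which bounds the upper limit, would be at most half of it. *)
move=> u01 lpos n; apply: contrapT => none.
have ub : bounded_fun (u : nat -> R^o).
  exists 1; split; first exact: num_real.
  move=> M M1 m _ /=; have /andP[h0 h1] := u01 m.
  by rewrite ger0_norm // (le_trans h1) // ltW.
have : limn_sup u <= sups u n.
  rewrite limn_supE //; apply: ge_inf; last by exists n.
  exact: bounded_fun_has_lbound_sups.
have : sups u n <= limn_sup u / 2.
  apply: ge_sup; first by exists (u n), n => //=.
  move=> _ [m nm <-]; rewrite leNgt; apply/negP => h; apply: none.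
  by exists m => //; apply: ltW.
by move=> h1 h2; have := le_trans h2 h1; rewrite leNgt ltr_pdivrMr // ltr_pMr // ltr1n.
Qed.

Unset Implicit Arguments.

Theorem theorem1p1 (d : nat) (E : set 'M[int]_d) :
  (2 <= d)%N ->
  (forall A, E A -> tracezero A) ->
  0 < upper_density E ->
  exists k : nat, (1 <= k)%N /\
    forall a : nat -> int,
      exists x y : 'M[int]_d, E x /\ E y /\
        char_poly (x - y) = scaled_poly d k%:Z a.
Proof.
move=> d2 _ Epos; set delta := upper_density E / 2.
have d0 : 0 < delta by rewrite divr_gt0.
have dens_avg n : dens_ratio E n = box_avg (fun x => (`[< E x >])%:R) n.
  congr (_ / _); rewrite -natr_sum; congr (_%:R).
  by elim: (F_list d n) => [|x s IH]; rewrite ?big_nil // big_cons -IH.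
have E_bdd : bdd (fun x : 'M[int]_d => (`[< E x >])%:R : Rdefinitions.R).
  by exists 1 => x; case: asboolP => _; rewrite ?normr1 ?normr0.
have freq : forall n, exists2 m, (n <= m)%N & delta <= dens_ratio E m.
  apply: limn_sup_frequently => // n; rewrite dens_avg.
  apply/andP; split.
    by rewrite -[leLHS](box_avg_cst d2 0 n); apply: (box_avg_le d2) => x; case: asboolP.
  by rewrite -[leRHS](box_avg_cst d2 1 n); apply: (box_avg_le d2) => x; case: asboolP.
have [L [LD LZ L1 Lge]] := generalized_limit Rdefinitions.R freq.
have [|k k0 hk] := mean_recurrence (box_meanD d2 LD) (box_meanZ d2 LZ)
  (box_mean_cst d2 LZ L1 1) (box_mean_ge0 d2 Lge) (box_mean_inv d2 LD LZ L1 Lge) d0 (E := E).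
  rewrite -(L_cst LZ L1 delta); apply: (L_le LD LZ Lge).
  - exact: bdd_cst.
  - exact: box_avg_bdd.
  - by exists 0%N => n _; rewrite dens_avg.
exists k; split=> // a.
(* The family realizes the polynomial at scale 1; multiplying the matrix by [k] at the end brings in
   the powers of [k]. *)
have [C [i [j [hC ij Cji]]]] := companion_matrix d2 (scaled_poly_monic d 1 a) (size_scaled_poly d 1 a).
have [s fs hs] := spanning_family ij Cji.
have cps x : char_poly (mev s x) = scaled_poly d 1 a.
  by rewrite (char_poly_conj_family x fs).
have s0 : (0 < size s)%N by rewrite lt0n size_eq0 (conj_family_neq0 fs).
have [|n [x [Ex Ey]]] := hk (size s).-1 (nth 0 s).
  (* A matrix and its projection act alike, and the projection has trace zero, hence lies in the
     lattice of coefficients. *)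
  move=> g; exists (trproj d2 g); last by rewrite /= (trproj_id d2 (mxtrace_trproj d2 g)).
  apply: (hs _ (mxtrace_trproj d2 g) (lat (size s).-1 (nth 0 s))).
  - exact: lat0.
  - by move=> Y Z hY hZ; apply: latD => //; apply: latN.
  - move=> Y /(nthP 0)[m]; rewrite size_behead nth_behead => ms <-.
    by apply: lat_coef; rewrite /=.
have pv : polyval (nth 0 s) (size s).-1 n = mev s n%:Z.
  by rewrite mevE /polyval prednK.
rewrite pv in Ey; set A := mev s n%:Z in pv Ey.
(* The coefficient of degree [d.-1] vanishes, so [A *+ k] is its own projection and is the
   difference of the two points of [E]. *)
have trA : \tr A = 0.
  apply/eqP; rewrite -oppr_eq0 -char_poly_trace; last exact: ltnW.
  by rewrite cps coef_scaled_poly_pred // ltnW.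
exists (x + trproj d2 (A *+ k)), x; split=> //; split=> //.
rewrite addrC addKr trproj_id; last by rewrite raddfMn /= trA mul0rn.
rewrite -[A *+ k]scaler_nat natz; exact: char_poly_scaled k0 (cps n).
Qed.
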